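(* Assume: $f=F\circ G$ and $h$ are convex; every $F_i$ is $L_F$-smooth with $B_F$-bounded gradient and every $G_j$ is $L_G$-smooth with $B_G$-bounded Jacobian; $\|[\nabla G_j(x)]^\top\nabla F_i(G(x))-[\nabla G_j(y)]^\top\nabla F_i(G(y))\|\le L\|x-y\|$ for all $i\in[n_1]$, $j\in[n_2]$ and $x,y\in\mathbb R^{N_2}$. Let $x^*$ be a minimizer of $H=f+h$, $H^*=H(x^* )$, and suppose $H(x_0)-H^*\le D_H$ and $\|x_0-x^*\|^2\le D_x$ with $D_H,D_x>0$. Let $0<\varepsilon<D_H$, $\mu_0=D_H/D_x$, $T=\log_2(D_H/\varepsilon)$ (rounded up to an integer), and assume $L\ge\mu_0$. Then the algorithm NoCK with these $\mu_0,T$, using SoCK with Option I as subroutine, can produce a stochastic $\varepsilon$-solution $x_T$, i.e. $\mathbb E[H(x_T)-H^*]\le\varepsilon$, with overall complexity $$O\left((n_1+n_2)\log\frac{D_H}{\varepsilon}+\frac{D_x^{2.5}\sqrt L\cdot\max\{B_G^4L_F^2,\,B_F^2L_G^2\}}{\varepsilon^{2.5}}+\frac{\sqrt{D_xL}\,n_1}{\sqrt\varepsilon}\right),$$ where the constant in $O(\cdot)$ is universal.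
   Context: Problem: $\min_{x\in\mathbb R^{N_2}}H(x)=f(x)+h(x)$ with $f=F\circ G$, $F=\frac1{n_1}\sum_{i=1}^{n_1}F_i$, $G=\frac1{n_2}\sum_{j=1}^{n_2}G_j$, where $F_i:\mathbb R^{N_1}\to\mathbb R$ and $G_j:\mathbb R^{N_2}\to\mathbb R^{N_1}$ are differentiable and $h:\mathbb R^{N_2}\to\mathbb R\cup\{+\infty\}$ is a proper closed convex function. $\nabla$ denotes the gradient of a scalar function and the Jacobian matrix of a vector-valued map; $\|\cdot\|$ is the Euclidean norm of vectors and the spectral norm of matrices; $[n]=\{1,\dots,n\}$. A differentiable map $\phi$ is $l$-smooth if $\|\nabla\phi(x)-\nabla\phi(x')\|\le l\|x-x'\|$ for all $x,x'$; it has $b$-bounded gradient/Jacobian if $\|\nabla\phi(x)\|\le b$ for all $x$. Algorithm NoCK. Input $x_0$, $\mu_0$, $T$. For $t=0,\dots,T-1$: let $H_t(x)=H(x)+\frac{\mu_t}2\|x-x_0\|^2$ with minimum value $H_t^*$; apply SoCK from starting point $x_t$ to $\min_xH_t(x)$, written as $f+h_t$ with $h_t=h+\frac{\mu_t}2\|\cdot-x_0\|^2$ (which is $\mu_t$-strongly convex), to find $x_{t+1}$ such that $\mathbb E[H_t(x_{t+1})-H_t^*\mid x_t]\le\frac14(H_t(x_t)-H_t^* )$; set $\mu_{t+1}=\mu_t/2$. Return $x_T$. Algorithm SoCK (Option I) for $\min f+h$ with $h$ $\mu$-strongly convex (in NoCK: $h:=h_t$, $\mu:=\mu_t$, starting point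 $x_t$). Parameters: $m=\lceil\frac12\sqrt{L/\mu}\rceil$, $\tau_1=\tau_2=\frac1{2m}$, $\theta=1+\frac1{12m}$, $\alpha=\frac1{3\tau_1L}$, $A=\frac{720B_G^4L_F^2}{\mu^2}$, $B=\frac{720B_F^2L_G^2}{\mu^2}$ (rounded up to the nearest positive integer), and a number $S$ of outer loops, which in NoCK is a sufficiently large universal constant. With starting point $x_0$ ($h(x_0)<\infty$), set $y_0=z_0=\widetilde x^0=x_0$. For $s=0,\dots,S-1$: compute $G(\widetilde x^s)$, $\nabla G(\widetilde x^s)$, $\nabla f(\widetilde x^s)$; for $j=0,\dots,m-1$, put $k=sm+j$ and (1) $x_{k+1}=\tau_1z_k+\tau_2\widetilde x^s+(1-\tau_1-\tau_2)y_k$; (2) draw multisets $\mathcal A_k,\mathcal B_k$ uniformly at random with replacement from $[n_2]$, with $|\mathcal A_k|=A$, $|\mathcal B_k|=B$ (all draws mutually independent); (3) $\widehat G_k=\frac1A\sum_{i\in\mathcal A_k}(G_i(x_{k+1})-G_i(\widetilde x^s))+G(\widetilde x^s)$ and $\nabla\widehat G_k=\frac1B\sum_{i\in\mathcal B_k}(\nabla G_i(x_{k+1})-\nabla G_i(\widetilde x^s))+\nabla G(\widetilde x^s)$; (4) $\widetilde\nabla_{k+1}=[\nabla\widehat G_k]^\top\nabla F(\widehat G_k)$; (5) $z_{k+1}=\arg\min_z\{\langle\widetilde\nabla_{k+1},z\rangle+\frac1{2\alpha}\|z-z_k\|^2+h(z)\}$; (6) $y_{k+1}=\arg\min_y\{\langle\widetilde\nabla_{k+1},y\rangle+\frac{3L}2\|y-x_{k+1}\|^2+h(y)\}$.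 After the inner loop, $\widetilde x^{s+1}=\big(\sum_{j=0}^{m-1}\theta^j\big)^{-1}\sum_{j=0}^{m-1}\theta^jy_{sm+j+1}$. Output $\widetilde x^S$. Overall complexity is the total, over all calls of SoCK, of the number of evaluations of $\nabla F_i$, $G_j$, $\nabla G_j$ and of the proximal mapping of $h_t$. In the complexity bound, $\log(\cdot)$ is read as $\max\{1,\log(\cdot)\}$. *)

(* Defs.v *)
From HB Require Import structures.
From mathcomp Require Export all_boot all_order all_algebra.
From mathcomp Require Export all_classical all_reals all_analysis.
Set Implicit Arguments.
Unset Strict Implicit.
Unset Printing Implicit Defensive.
Export Order.TTheory GRing.Theory Num.Theory.
Export numFieldNormedType.Exports.
#[export] Set Implicit Arguments.
#[export] Unset Strict Implicit.
#[export] Unset Printing Implicit Defensive.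

Local Open Scope classical_set_scope.
Local Open Scope ring_scope.

(* Points of R^N are column vectors 'cV[R]_N.  The
   library norm on matrices is the sup norm; it only serves here to provide the
   topology and differentiability, which do not depend on the norm. *)

Section Euclidean.
Context {R : realType}.

Definition dotv n (u v : 'cV[R]_n) : R := (u^T *m v) 0 0.

Definition l2norm n (v : 'cV[R]_n) : R := Num.sqrt (\sum_i v i 0 ^+ 2).

(* Spectral norm, i.e. the operator norm induced by the Euclidean norms. *)
Definition opnorm m n (M : 'M[R]_(m, n)) : R :=
  sup [set l2norm (M *m v) | v in [set v : 'cV[R]_n | l2norm v <= 1]].

Definition grad n (f : 'cV[R]_n -> R) (x : 'cV[R]_n) : 'cV[R]_n :=
  \col_i 'D_(delta_mx i 0) f x.

(* The library's [jacobian] is for maps between row vectors and is the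
   transpose of the Jacobian matrix. *)
Definition jac m n (g : 'cV[R]_n -> 'cV[R]_m) (x : 'cV[R]_n) : 'M[R]_(m, n) :=
  \matrix_(i, j) ('D_(delta_mx j 0) g x) i 0.

(* Convexity of an extended-valued function that never takes the value -oo;
   the library convention 0 * +oo = 0 makes the cases t = 0, 1 harmless. *)
Definition econvex n (h : 'cV[R]_n -> \bar R) : Prop :=
  forall (x y : 'cV[R]_n) (t : R), 0 <= t <= 1 ->
    (h (t *: x + (1 - t) *: y)%R <= t%:E * h x + (1 - t)%:E * h y)%E.

Definition proper_closed_convex n (h : 'cV[R]_n -> \bar R) : Prop :=
  [/\ forall x, h x != -oo%E, exists x, h x != +oo%E,
      lower_semicontinuous h & econvex h].

(* A minimizer of phi (a default value when there is none). *)
Definition argmin n (phi : 'cV[R]_n -> \bar R) : 'cV[R]_n :=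
  xget 0 [set z | forall w, (phi z <= phi w)%E].

(* Rounding up to a natural number, meant for x >= 0. *)
Definition nceil (x : R) : nat := `|Num.ceil x|%N.

Definition mean (I : finType) (V : lmodType R) (v : I -> V) : V :=
  #|I|%:R^-1 *: \sum_i v i.

End Euclidean.

(* Computations instrumented with the number of oracle calls they make. *)
Section Counting.

Definition counted (X : Type) : Type := (X * nat)%type.
Definition ret X (x : X) : counted X := (x, 0%N).
Definition tick X (x : X) : counted X := (x, 1%N).
Definition bind X Y (c : counted X) (k : X -> counted Y) : counted Y :=
  ((k c.1).1, (c.2 + (k c.1).2)%N).

Definition cfold X I (body : X -> I -> counted X) (x : X) (s : seq I) :
    counted X :=
  foldl (fun c i => bind c (body^~ i)) (ret x) s.

Definition cmean (R : realType) (I : finType) (V : lmodType R)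
    (c : I -> counted V) : counted V :=
  (mean (fun i => (c i).1), (\sum_i (c i).2)%N).

End Counting.

Notation "'let!' x ':=' c 'in' k" := (bind c (fun x => k))
  (at level 200, x name, c at level 100, k at level 200,
   format "'let!'  x  ':='  c  'in' '//' k").

Section Algorithms.
Context {R : realType} {N1 N2 n1 n2 : nat}.
Variable F : 'I_n1 -> 'cV[R]_N1 -> R.
Variable G : 'I_n2 -> 'cV[R]_N2 -> 'cV[R]_N1.

Definition Fbar (u : 'cV[R]_N1) : R := n1%:R^-1 * \sum_i F i u.
Definition Gbar (x : 'cV[R]_N2) : 'cV[R]_N1 := n2%:R^-1 *: \sum_j G j x.
Definition fobj (x : 'cV[R]_N2) : R := Fbar (Gbar x).

Variables (L_F B_F L_G B_G L : R).

Definition sock_m (mu : R) : nat := nceil (2^-1 * Num.sqrt (L / mu)).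
Definition sock_A (mu : R) : nat :=
  maxn 1 (nceil (720 * B_G ^+ 4 * L_F ^+ 2 / mu ^+ 2)).
Definition sock_B (mu : R) : nat :=
  maxn 1 (nceil (720 * B_F ^+ 2 * L_G ^+ 2 / mu ^+ 2)).

Definition eval_gradF i u : counted 'cV[R]_N1 := tick (grad (F i) u).
Definition eval_G j x : counted 'cV[R]_N1 := tick (G j x).
Definition eval_jacG j x : counted 'M[R]_(N1, N2) := tick (jac (G j) x).

(* z |-> argmin { <g, z> + c |z - w|^2 + h z } *)
Definition eval_prox (h : 'cV[R]_N2 -> \bar R) (c : R) (g w : 'cV[R]_N2) :
    counted 'cV[R]_N2 :=
  tick (argmin (fun z => (dotv g z + c * l2norm (z - w) ^+ 2)%:E + h z)%E).

(* Number of outer loops. *)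
Variable S : nat.

Section SoCK.
Variables (h : 'cV[R]_N2 -> \bar R) (mu : R).

Let m := sock_m mu.
Let A := sock_A mu.
Let B := sock_B mu.
Let tau : R := (2 * m%:R)^-1.
Let theta : R := 1 + (12 * m%:R)^-1.
Let alpha : R := (3 * tau * L)^-1.

(* State: (y_k, z_k, sum_(j' < j) theta^j' y_(sm+j'+1)).  The arguments xt, Gt
   and Jt are the snapshot point and the values of G and of its Jacobian there;
   aA and aB list the indices in the multisets A_k and B_k. *)
Definition sock_inner (xt : 'cV[R]_N2) (Gt : 'cV[R]_N1) (Jt : 'M[R]_(N1, N2))
    (aA : 'I_m -> 'I_A -> 'I_n2) (aB : 'I_m -> 'I_B -> 'I_n2)
    (st : 'cV[R]_N2 * 'cV[R]_N2 * 'cV[R]_N2) (j : 'I_m) :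
    counted ('cV[R]_N2 * 'cV[R]_N2 * 'cV[R]_N2) :=
  let: (y, z, w) := st in
  let x := tau *: z + tau *: xt + (1 - tau - tau) *: y in
  let! dG := cmean (fun i => let! u := eval_G (aA j i) x in
                             let! v := eval_G (aA j i) xt in ret (u - v)) in
  let! dJ := cmean (fun i => let! U := eval_jacG (aB j i) x in
                             let! V := eval_jacG (aB j i) xt in ret (U - V)) in
  let! gF := cmean (fun i => eval_gradF i (dG + Gt)) in
  let g := (dJ + Jt)^T *m gF in
  let! z' := eval_prox h (2 * alpha)^-1 g z in
  let! y' := eval_prox h (3 * L / 2) g x in
  ret (y', z', w + theta ^+ j *: y').

(* State: (xt^s, y_(sm), z_(sm)).  The full gradient of f at the snapshot point
   is computed (and paid for), although Option I makes no further use of it. *)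
Definition sock_outer (aA : 'I_S -> 'I_m -> 'I_A -> 'I_n2)
    (aB : 'I_S -> 'I_m -> 'I_B -> 'I_n2)
    (st : 'cV[R]_N2 * 'cV[R]_N2 * 'cV[R]_N2) (s : 'I_S) :
    counted ('cV[R]_N2 * 'cV[R]_N2 * 'cV[R]_N2) :=
  let: (xt, y, z) := st in
  let! Gt := cmean (fun j => eval_G j xt) in
  let! Jt := cmean (fun j => eval_jacG j xt) in
  let! gradf := (let! gF := cmean (fun i => eval_gradF i Gt) in
                 ret (Jt^T *m gF)) in
  let! r := cfold (sock_inner xt Gt Jt (aA s) (aB s)) (y, z, 0)
                  (enum 'I_m) in
  let: (y', z', w) := r in
  ret ((\sum_(j < m) theta ^+ j)^-1 *: w, y', z').

Definition sock (x0 : 'cV[R]_N2) (aA : 'I_S -> 'I_m -> 'I_A -> 'I_n2)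
    (aB : 'I_S -> 'I_m -> 'I_B -> 'I_n2) : counted 'cV[R]_N2 :=
  let! r := cfold (sock_outer aA aB) (x0, x0, x0) (enum 'I_S) in
  ret r.1.1.

End SoCK.

Section NoCK.
Variables (h : 'cV[R]_N2 -> \bar R) (x0 : 'cV[R]_N2) (mu0 : R) (T : nat).

Definition nock_mu (t : nat) : R := iter t (fun mu => mu / 2) mu0.

Definition nock_h (t : nat) (x : 'cV[R]_N2) : \bar R :=
  (h x + (nock_mu t / 2 * l2norm (x - x0) ^+ 2)%:E)%E.

Definition Hobj (x : 'cV[R]_N2) : \bar R := ((fobj x)%:E + h x)%E.

Definition nock_H (t : nat) (x : 'cV[R]_N2) : \bar R :=
  (Hobj x + (nock_mu t / 2 * l2norm (x - x0) ^+ 2)%:E)%E.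

Definition nock_Hmin (t : nat) : \bar R := ereal_inf (range (nock_H t)).

(* The draws of the t-th call of SoCK: (s, j, inl i) is the i-th draw of the
   multiset A_(sm+j), (s, j, inr i) the i-th draw of B_(sm+j). *)
Definition draw_idx (t : 'I_T) : finType :=
  ('I_S * 'I_(sock_m (nock_mu t)) *
   ('I_(sock_A (nock_mu t)) + 'I_(sock_B (nock_mu t))))%type.

(* Independent uniform draws from [n2] amount to the uniform distribution on
   the finite set of all families of draws. *)
Definition draws : finType := {ffun {t : 'I_T & draw_idx t} -> 'I_n2}.

(* The iterate x_t, together with the cost of the first t calls of SoCK. *)
Definition nock (d : draws) (t : nat) : counted 'cV[R]_N2 :=
  cfold (fun x (i : 'I_T) =>
           sock (mu := nock_mu i) (nock_h i) x
             (fun s j k => d (@Tagged 'I_T i draw_idx (s, j, inl k)))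
             (fun s j k => d (@Tagged 'I_T i draw_idx (s, j, inr k))))
        x0 (take t (enum 'I_T)).

Definition nock_x (t : nat) (d : draws) : 'cV[R]_N2 := (nock d t).1.
Definition nock_cost (d : draws) : nat := (nock d T).2.

End NoCK.
End Algorithms.

Arguments nock_x {R N1 N2 n1 n2} F G L_F B_F L_G B_G L S h x0 mu0 T t d.
Arguments nock_cost {R N1 N2 n1 n2} F G L_F B_F L_G B_G L S h x0 mu0 T d.

(* Expectations under the uniform distribution on a finite type. *)
Section Expectation.
Context {R : realType} {W : finType}.

Definition uavg (P : {set W}) (Z : W -> \bar R) : \bar R :=
  ((#|P|%:R^-1)%:E * \sum_(w in P) Z w)%E.

Definition expect (Z : W -> \bar R) : \bar R := uavg [set: W]%SET Z.

(* E[Z | X] *)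
Definition condexpect (V : eqType) (Z : W -> \bar R) (X : W -> V) (w : W) :
    \bar R :=
  uavg [set w' | X w' == X w]%SET Z.

End Expectation.

(* Main.v *)
Require Import Defs.
From mathcomp Require Import ring lra zify.
Local Open Scope classical_set_scope.
Local Open Scope ring_scope.

(** SoCK is a Katyusha-type method driven by a biased estimator g of the
    gradient of f at x.  Once the draws A_k are fixed, the vector
    v = grad F(Ghat) is fixed, so the Jacobian part (Jhat - J)^T v of the error
    is a mean of independent centered vectors: no concentration of matrices is
    needed, and E|g - grad f(x)|^2 <= (mu^2/180) |x - xt|^2, where xt is the
    snapshot point.  By strong convexity |x - xt|^2 is controlled by the gaps
    H(xt) - min H, H(y) - min H and by |x_min - z|^2, and Young's inequality
    absorbs the bias into the strongly convex term.  Telescoping with the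
    weights theta^j, the potential
      (19/18) tau Theta (H(xt) - min H) + rho (H(y) - min H) + K |x_min - z|^2,
    Theta = sum_j theta^j, shrinks by the factor 12/13 in every outer loop, so
    that a universal number of outer loops divides the gap of H_t by 12.

    The gaps of H_t(x_t) then halve at every call as mu_t does.  The factor 1/12
    (rather than 1/4) serves the last call, where
      H(x_T) - min H <= 2 (H_t(x_T) - min H_t) + (mu_t/3) D_x,  t = T - 1. *)

(** * Euclidean norm and operator norm *)

Section EuclideanTheory.
Context {R : realType}.
Implicit Types (n : nat) (a b : R).

(** Young's inequality replaces it at the price (2/mu) |g - grad f(x)|^2, affordable because the
    batches are of order 1/mu^2: the constant 720 gives 2 (1/720 + 1/720) = 1/180, and the resulting
    perturbations, tau/18 on the gaps and tau mu/72 on |u - z|^2, are small against the gain from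
    strong convexity.

    Probability stays finite: expectations are sums over a set [P] of draw families whose membership
    ignores the draws of the current call. With [P] a level set of x_t or the whole space, one
    estimate serves both the conditional and the total expectation.

    Since h may take the value +oo, inequalities are stated for its finite part on the effective
    domain [D], which the iterates never leave. *)

Lemma dotvE n (u v : 'cV[R]_n) : dotv u v = \sum_i u i 0 * v i 0.
Proof. by rewrite /dotv mxE; apply: eq_bigr => i _; rewrite mxE. Qed.

Lemma dotvC n (u v : 'cV[R]_n) : dotv u v = dotv v u.
Proof. by rewrite !dotvE; apply: eq_bigr => i _; rewrite mulrC. Qed.

Lemma dotvDr n (u v w : 'cV[R]_n) : dotv u (v + w) = dotv u v + dotv u w.
Proof. by rewrite /dotv mulmxDr mxE. Qed.

Lemma dotvZr n a (u v : 'cV[R]_n) : dotv u (a *: v) = a * dotv u v.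
Proof. by rewrite /dotv -scalemxAr mxE. Qed.

Lemma dotvNr n (u v : 'cV[R]_n) : dotv u (- v) = - dotv u v.
Proof. by rewrite -scaleN1r dotvZr mulN1r. Qed.

Lemma dotv0r n (u : 'cV[R]_n) : dotv u 0 = 0.
Proof. by rewrite -(scale0r 0) dotvZr mul0r. Qed.

Lemma dotvDl n (u v w : 'cV[R]_n) : dotv (v + w) u = dotv v u + dotv w u.
Proof. by rewrite !(dotvC _ u) dotvDr. Qed.

Lemma dotvZl n a (u v : 'cV[R]_n) : dotv (a *: v) u = a * dotv v u.
Proof. by rewrite !(dotvC _ u) dotvZr. Qed.

Lemma dotvNl n (u v : 'cV[R]_n) : dotv (- v) u = - dotv v u.
Proof. by rewrite !(dotvC _ u) dotvNr. Qed.

Definition dotvL := (dotvDl, dotvDr, dotvZl, dotvZr, dotvNl, dotvNr).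

Lemma dotv_sumr n (I : Type) (r : seq I) (P : pred I) (u : 'cV[R]_n) F :
  dotv u (\sum_(i <- r | P i) F i) = \sum_(i <- r | P i) dotv u (F i).
Proof.
elim/big_rec2 : _ => [|i x y _ <-]; first exact: dotv0r.
exact: dotvDr.
Qed.

Lemma dotv_suml n (I : Type) (r : seq I) (P : pred I) (u : 'cV[R]_n) F :
  dotv (\sum_(i <- r | P i) F i) u = \sum_(i <- r | P i) dotv (F i) u.
Proof. by rewrite dotvC dotv_sumr; apply: eq_bigr => i _; rewrite dotvC. Qed.

Lemma sqr_l2norm n (v : 'cV[R]_n) : l2norm v ^+ 2 = dotv v v.
Proof.
rewrite /l2norm sqr_sqrtr; last by apply: sumr_ge0 => i _; exact: sqr_ge0.
by rewrite dotvE; apply: eq_bigr => i _; rewrite expr2.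
Qed.

Lemma l2norm_ge0 n (v : 'cV[R]_n) : 0 <= l2norm v.
Proof. exact: sqrtr_ge0. Qed.

Lemma dotvv_ge0 n (v : 'cV[R]_n) : 0 <= dotv v v.
Proof. by rewrite -sqr_l2norm sqr_ge0. Qed.

Lemma l2norm0 n : l2norm (0 : 'cV[R]_n) = 0.
Proof. by apply/eqP; rewrite -sqrf_eq0 sqr_l2norm dotv0r. Qed.

Lemma l2norm_le n (v : 'cV[R]_n) b :
  0 <= b -> dotv v v <= b ^+ 2 -> l2norm v <= b.
Proof. by move=> b0; rewrite -sqr_l2norm ler_pXn2r// nnegrE// l2norm_ge0. Qed.

Lemma dotvv_le n (v : 'cV[R]_n) b : l2norm v <= b -> dotv v v <= b ^+ 2.
Proof.
move=> vb; rewrite -sqr_l2norm ler_pXn2r// nnegrE ?l2norm_ge0//.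
exact: le_trans (l2norm_ge0 v) vb.
Qed.

Lemma l2normZ n a (v : 'cV[R]_n) : l2norm (a *: v) = `|a| * l2norm v.
Proof.
apply/eqP; rewrite -(@eqrXn2 _ 2)// ?mulr_ge0 ?l2norm_ge0//.
by rewrite exprMn !sqr_l2norm dotvZl dotvZr real_normK ?num_real// mulrA expr2.
Qed.

Lemma l2normN n (v : 'cV[R]_n) : l2norm (- v) = l2norm v.
Proof. by rewrite -scaleN1r l2normZ normrN1 mul1r. Qed.

Lemma young n a (u v : 'cV[R]_n) : 0 < a ->
  dotv u v <= a / 2 * dotv u u + a^-1 / 2 * dotv v v.
Proof.
move=> a0; have := dotvv_ge0 (a *: u - v); rewrite !dotvL (dotvC v u).
move=> le0; rewrite -(ler_pM2l a0).
have -> : a * (a / 2 * dotv u u + a^-1 / 2 * dotv v v)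
   = (a ^+ 2 * dotv u u + dotv v v) / 2 by field; rewrite gt_eqF.
lra.
Qed.

(** The ratio of the norms is the optimal parameter in [young]; if one norm vanishes, a very large
    or very small parameter leaves an error of at most [e]. *)
Lemma cauchy_schwarz n (u v : 'cV[R]_n) : dotv u v <= l2norm u * l2norm v.
Proof.
apply/ler_addgt0Pr => e e0.
have [u0|un0] := eqVneq (l2norm u) 0.
  have uu0 : dotv u u = 0 by rewrite -sqr_l2norm u0 expr2 mul0r.
  rewrite u0 mul0r add0r.
  pose a := (dotv v v + 1) / (2 * e).
  have vv0 := dotvv_ge0 v.
  have a0 : 0 < a by rewrite divr_gt0//; lra.
  have := young u v a0; rewrite uu0 mulr0 add0r => /le_trans; apply.
  have -> : a^-1 / 2 * dotv v v = e * (dotv v v / (dotv v v + 1)).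
    by rewrite /a; field; rewrite ?gt_eqF//; lra.
  by rewrite ler_piMr ?(ltW e0)// ler_pdivrMr ?mul1r; lra.
have u_gt0 : 0 < l2norm u by rewrite lt_neqAle eq_sym un0 l2norm_ge0.
have [v0|vn0] := eqVneq (l2norm v) 0.
  have vv0 : dotv v v = 0 by rewrite -sqr_l2norm v0 expr2 mul0r.
  rewrite v0 mulr0 add0r.
  have uu0 := dotvv_ge0 u.
  pose a := 2 * e / (dotv u u + 1).
  have a0 : 0 < a by rewrite divr_gt0//; lra.
  have := young u v a0; rewrite vv0 mulr0 addr0 => /le_trans; apply.
  have -> : a / 2 * dotv u u = e * (dotv u u / (dotv u u + 1)).
    by rewrite /a; field; rewrite ?gt_eqF//; lra.
  by rewrite ler_piMr ?(ltW e0)// ler_pdivrMr ?mul1r; lra.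
have v_gt0 : 0 < l2norm v by rewrite lt_neqAle eq_sym vn0 l2norm_ge0.
have := @young _ (l2norm v / l2norm u) u v (divr_gt0 v_gt0 u_gt0).
rewrite -!sqr_l2norm => /le_trans; apply.
rewrite [leLHS](_ : _ = l2norm u * l2norm v); last by field; rewrite un0 vn0.
by rewrite lerDl ltW.
Qed.

Lemma l2normD n (u v : 'cV[R]_n) : l2norm (u + v) <= l2norm u + l2norm v.
Proof.
apply: l2norm_le; first by rewrite addr_ge0 ?l2norm_ge0.
rewrite !dotvL (dotvC v u) sqrrD !sqr_l2norm.
have := cauchy_schwarz u v; lra.
Qed.

Lemma l2norm_sum n (I : Type) (r : seq I) (P : pred I) (F : I -> 'cV[R]_n) :
  l2norm (\sum_(i <- r | P i) F i) <= \sum_(i <- r | P i) l2norm (F i).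
Proof.
elim/big_ind2 : _ => [|x1 x2 y1 y2 h1 h2|//]; first by rewrite l2norm0.
exact: le_trans (l2normD _ _) (lerD h1 h2).
Qed.

Lemma l2norm_mean n (I : finType) (v : I -> 'cV[R]_n) b : (0 < #|I|)%N ->
  (forall i, l2norm (v i) <= b) -> l2norm (mean v) <= b.
Proof.
move=> I0 vb; rewrite /mean l2normZ ger0_norm ?invr_ge0//.
rewrite ler_pdivrMl ?ltr0n// (le_trans (l2norm_sum _ _ _))//.
rewrite mulr_natl -sumr_const; exact: ler_sum.
Qed.

Lemma dotv_trmulmx m n (M : 'M[R]_(m, n)) (u : 'cV[R]_m) (v : 'cV[R]_n) :
  dotv (M^T *m u) v = dotv u (M *m v).
Proof. by rewrite /dotv trmx_mul trmxK mulmxA. Qed.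

Let opset m n (M : 'M[R]_(m, n)) :=
  [set l2norm (M *m v) | v in [set v : 'cV[R]_n | l2norm v <= 1]].

Let has_sup_opset m n (M : 'M[R]_(m, n)) : has_sup (opset M).
Proof.
split; first by exists (l2norm (M *m 0)); exists 0 => //=; rewrite l2norm0 ler01.
(* Only boundedness matters: with S the sum of the squared row norms, |M v|^2 <= S <= (1 + S)^2. *)
exists (1 + \sum_i dotv (row i M)^T (row i M)^T) => _ [v /= v1 <-].
have S0 : 0 <= \sum_i dotv (row i M)^T (row i M)^T.
  by apply: sumr_ge0 => i _; exact: dotvv_ge0.
apply: l2norm_le; first by rewrite addr_ge0.
apply: (@le_trans _ _ (\sum_i dotv (row i M)^T (row i M)^T)); last by nra.
rewrite dotvE; apply: ler_sum => i _.
have -> : (M *m v) i 0 = dotv (row i M)^T v.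
  by rewrite /dotv trmxK -row_mul [RHS]mxE.
rewrite -expr2 -sqr_l2norm -[leLHS]ger0_norm ?sqr_ge0// normrX.
rewrite ler_pXn2r ?nnegrE ?l2norm_ge0//.
have cs w : dotv w v <= l2norm w.
  apply: le_trans (cauchy_schwarz _ _) _.
  by rewrite ler_piMr ?l2norm_ge0.
rewrite ler_norml cs andbT lerNl -dotvNl -(l2normN (row i M)^T); exact: cs.
Qed.

Lemma opnorm_ge0 m n (M : 'M[R]_(m, n)) : 0 <= opnorm M.
Proof.
apply: le_trans (l2norm_ge0 (M *m 0)) _.
apply: (ub_le_sup (proj2 (has_sup_opset M))).
by exists 0 => //=; rewrite l2norm0 ler01.
Qed.

Lemma l2norm_mulmx m n (M : 'M[R]_(m, n)) v :
  l2norm (M *m v) <= opnorm M * l2norm v.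
Proof.
have [v0|vn0] := eqVneq (l2norm v) 0.
  suff -> : v = 0 by rewrite mulmx0 !l2norm0 mulr0.
  apply/colP => i; rewrite mxE.
  have /eqP : dotv v v = 0 by rewrite -sqr_l2norm v0 expr2 mul0r.
  rewrite dotvE psumr_eq0; last by move=> j _; rewrite -expr2 sqr_ge0.
  by move/allP => /(_ i (mem_index_enum _)); rewrite -expr2 sqrf_eq0 => /eqP.
have v_gt0 : 0 < l2norm v by rewrite lt_neqAle eq_sym vn0 l2norm_ge0.
rewrite -ler_pdivrMr// mulrC -[X in X * _]ger0_norm ?invr_ge0 ?l2norm_ge0//.
rewrite -l2normZ scalemxAr.
apply: (ub_le_sup (proj2 (has_sup_opset M))); exists ((l2norm v)^-1 *: v) => //=.
by rewrite l2normZ ger0_norm ?invr_ge0 ?l2norm_ge0// mulVf.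
Qed.

(** Here |M^T u|^2 = <u, M M^T u> is at most |u| |M| |M^T u|, and a factor |M^T u| cancels. *)
Lemma l2norm_trmulmx m n (M : 'M[R]_(m, n)) u :
  l2norm (M^T *m u) <= opnorm M * l2norm u.
Proof.
have [v0|vn0] := eqVneq (l2norm (M^T *m u)) 0.
  by rewrite v0 mulr_ge0 ?opnorm_ge0 ?l2norm_ge0.
have v_gt0 : 0 < l2norm (M^T *m u) by rewrite lt_neqAle eq_sym vn0 l2norm_ge0.
rewrite -(ler_pM2r v_gt0) -expr2 sqr_l2norm dotv_trmulmx.
apply: le_trans (cauchy_schwarz _ _) _.
by rewrite [leRHS]mulrAC [leRHS]mulrC ler_wpM2l ?l2norm_ge0// l2norm_mulmx.
Qed.

End EuclideanTheory.

(** * Gradients and Jacobians *)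

Section Calculus.
Context {R : realType}.

Lemma cV_sum_delta n (v : 'cV[R]_n) : v = \sum_i v i 0 *: delta_mx i 0.
Proof.
rewrite {1}(matrix_sum_delta v); apply: eq_bigr => i _.
by rewrite big_ord1.
Qed.

Lemma diff_grad n (f : 'cV[R]_n -> R) x v : differentiable f x ->
  'd f x v = dotv (grad f x) v.
Proof.
move=> df; rewrite {1}(cV_sum_delta v) linear_sum dotvE; apply: eq_bigr => i _.
by rewrite linearZ /= mxE deriveE// mulrC.
Qed.

Lemma diff_jac m n (g : 'cV[R]_n -> 'cV[R]_m) x v : differentiable g x ->
  'd g x v = jac g x *m v.
Proof.
move=> df; rewrite {1}(cV_sum_delta v) linear_sum; apply/colP => i.
rewrite summxE mxE; apply: eq_bigr => j _.
by rewrite linearZ /= !mxE deriveE// mulrC.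
Qed.

Lemma is_derive_line (n : nat) (V : normedModType R) (f : 'cV[R]_n -> V) x v t :
  differentiable f (x + t *: v) ->
  is_derive t 1 (fun s : R => f (x + s *: v)) ('d f (x + t *: v) v).
Proof.
move=> df.
have dl : is_diff t (fun s : R => x + s *: v) (fun s => s *: v).
  have -> : (fun s : R => x + s *: v) = cst x + ( *:%R ^~ v) by [].
  apply: (is_diff_eq (is_diffD (is_diff_cst x t) (is_diff_scalel t v))).
  by apply/funext => s; rewrite !fctE add0r.
have dfl : is_diff t (f \o (fun s : R => x + s *: v)) ('d f (x + t *: v) \o (fun s => s
  *: v)).
  exact: is_diff_comp.
split; first by apply: diff_derivable; exact: ex_diff.
rewrite deriveE; last exact: ex_diff.
by rewrite diff_val /= scale1r.
Qed.

(** The free terms t a + t^2 b let a single mean value theorem yield second-order bounds with the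
    sharp constant L/2: they are chosen so that the derivative at the unknown point c has a sign. *)
Lemma line_MVT n (f : 'cV[R]_n -> R) (x v : 'cV[R]_n) (a b : R) :
  (forall y, differentiable f y) ->
  exists2 c, 0 <= c <= 1 & 
    f (x + v) + a + b - f x = dotv (grad f (x + c *: v)) v + a + 2 * b * c.
Proof.
move=> df.
pose phi (t : R) := f (x + t *: v) + t * a + t ^+ 2 * b.
have dphi (t : R^o) : is_derive t (1 : R^o) (phi : R^o -> R^o) (dotv (grad f (x + t *:
  v)) v + a + 2 * b * t).
  rewrite -diff_grad//.
  have h1 : is_derive t (1:R^o) (fun s : R^o => f (x + s *: v)) ('d f (x + t *: v) v).
    exact: is_derive_line.
  have -> : phi = (fun s : R => f (x + s *: v)) + a *: id + b *: (id ^+ 2).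
    by apply/funext => s; rewrite /phi !fctE /= /GRing.scale /= [a * _]mulrC [b * _]mulrC.
  apply: (is_derive_eq (is_deriveD (is_deriveD h1 (is_deriveZ a (is_derive_id t 1)))
    (is_deriveZ b (is_deriveX 2 (is_derive_id t 1))))).
  by rewrite /GRing.scale /=; ring.
have cphi : {within `[0, 1], continuous phi}.
  apply: continuous_subspaceT => t.
  by apply: differentiable_continuous; apply/derivable1_diffP; exact: ex_derive.
have [c c01 e] := MVT_segment ler01 (fun t _ => dphi t) cphi.
exists c; first by move: c01; rewrite in_itv.
move: e; rewrite subr0 mulr1 /phi scale1r scale0r addr0 !mul0r expr0n /= mul0r expr1n
  !mul1r !addr0.
by move=> <-.
Qed.

Lemma differentiable_mean (k n : nat) (V : normedModType R) (f : 'I_k -> 'cV[R]_n -> V)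
  x :
  (forall i, differentiable (f i) x) ->
  differentiable (fun y => k%:R^-1 *: \sum_i f i y) x.
Proof.
move=> df.
have -> : (fun y => k%:R^-1 *: \sum_i f i y) = k%:R^-1 *: (\sum_i f i).
  by apply/funext => y; rewrite /= !fctE fct_sumE.
exact/differentiableZ/differentiable_sum.
Qed.

Lemma derive_mean (k n : nat) (V : normedModType R) (f : 'I_k -> 'cV[R]_n -> V) x v :
  (forall i, differentiable (f i) x) ->
  'D_v (fun y => k%:R^-1 *: \sum_i f i y) x = k%:R^-1 *: \sum_i 'D_v (f i) x.
Proof.
move=> df.
have -> : (fun y => k%:R^-1 *: \sum_i f i y) = k%:R^-1 *: (\sum_i f i).
  by apply/funext => y; rewrite /= !fctE fct_sumE.
rewrite deriveZ; last by apply: derivable_sum => i; exact: diff_derivable.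
by rewrite derive_sum// => i; exact: diff_derivable.
Qed.

Lemma grad_mean (k n : nat) (f : 'I_k -> 'cV[R]_n -> R) x :
  (forall i, differentiable (f i) x) ->
  grad (fun y => k%:R^-1 * \sum_i f i y) x = mean (fun i => grad (f i) x).
Proof.
move=> df; apply/colP => i; rewrite /mean card_ord !mxE summxE.
rewrite (derive_mean _ df) /GRing.scale /=; congr (_ * _).
by apply: eq_bigr => j _; rewrite mxE.
Qed.

Lemma jac_mean (k m n : nat) (f : 'I_k -> 'cV[R]_n -> 'cV[R]_m) x :
  (forall i, differentiable (f i) x) ->
  jac (fun y => k%:R^-1 *: \sum_i f i y) x = mean (fun i => jac (f i) x).
Proof.
move=> df; apply/matrixP => i j; rewrite /mean card_ord !mxE summxE.
rewrite (derive_mean _ df) mxE summxE; congr (_ * _).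
by apply: eq_bigr => l _; rewrite mxE.
Qed.

Lemma grad_comp m n (f : 'cV[R]_m -> R) (g : 'cV[R]_n -> 'cV[R]_m) x :
  differentiable g x -> differentiable f (g x) ->
  grad (f \o g) x = (jac g x)^T *m grad f (g x).
Proof.
move=> dg df; apply/colP => i; rewrite mxE deriveE; last exact: differentiable_comp.
rewrite diff_comp//= diff_grad// diff_jac// -dotv_trmulmx dotvE (bigD1 i)//=.
rewrite [delta_mx i 0 i 0]mxE !eqxx mulr1 big1 ?addr0// => j ji.
by rewrite [delta_mx i 0 _ _]mxE (negbTE ji) mulr0.
Qed.

Lemma lipschitz_grad n (f : 'cV[R]_n -> R) b x y :
  (forall z, differentiable f z) -> (forall z, l2norm (grad f z) <= b) ->
  f x - f y <= b * l2norm (x - y).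
Proof.
move=> df gb; have [c _] := @line_MVT n f y (x - y) 0 0 df.
rewrite subrKC !addr0 mulr0 mul0r addr0 => ->.
apply: le_trans (cauchy_schwarz _ _) _.
by rewrite ler_wpM2r ?l2norm_ge0.
Qed.

(** The mean value theorem is scalar, so it is applied to <u, g> with u = g x - g y; this gives
    |u|^2 <= b |u| |x - y|. *)
Lemma lipschitz_jac m n (g : 'cV[R]_n -> 'cV[R]_m) b x y :
  (forall z, differentiable g z) -> (forall z, opnorm (jac g z) <= b) ->
  l2norm (g x - g y) <= b * l2norm (x - y).
Proof.
move=> dg gb.
pose u := g x - g y.
have du z : differentiable (dotv u) z.
  have -> : dotv u = \sum_i (u i 0 *: (fun w : 'cV[R]_m => w i 0 : R)).
    by apply/funext => w; rewrite dotvE fct_sumE.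
  apply: differentiable_sum => i; apply: differentiableZ.
  exact: differentiable_coord.
have gu z : grad (dotv u) z = u.
  apply/colP => i; rewrite mxE /derive.
  have -> : (fun h : R => h^-1 *: ((dotv u \o shift z) (h *: delta_mx i 0) - dotv u z))
     = (fun h => h^-1 * h * u i 0).
    apply/funext => h /=; rewrite /GRing.scale /= -dotvNr -dotvDr addrK dotvZr -mulrA.
    congr (_ * (_ * _)); rewrite dotvE (bigD1 i)//= big1 ?addr0.
      by rewrite [delta_mx _ _ _ _]mxE !eqxx mulr1.
    by move=> j ji; rewrite [delta_mx _ _ _ _]mxE (negbTE ji) mulr0.
  apply/cvg_lim => //.
  apply: cvg_near_cst.
  near=> h; rewrite mulVf ?mul1r//; near: h; exact: nbhs_dnbhs_neq.
have dgu z : differentiable (dotv u \o g) z by exact: differentiable_comp.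
have := @lipschitz_grad n (dotv u \o g) (b * l2norm u) x y dgu.
have gl z : l2norm (grad (dotv u \o g) z) <= b * l2norm u.
  rewrite grad_comp// gu (le_trans (l2norm_trmulmx _ _))//.
  by rewrite ler_wpM2r ?l2norm_ge0.
move=> /(_ gl) /=; rewrite -dotvNr -dotvDr -/u -sqr_l2norm.
have [->|un0] := eqVneq (l2norm u) 0.
  move=> _; rewrite mulr_ge0 ?l2norm_ge0//; exact: le_trans (opnorm_ge0 _) (gb x).
have u_gt0 : 0 < l2norm u by rewrite lt_neqAle eq_sym un0 l2norm_ge0.
by rewrite mulrAC expr2 ler_pM2r.
Unshelve. all: by end_near.
Qed.

Section Smooth.
Variables (n : nat) (f : 'cV[R]_n -> R) (L : R).
Hypothesis df : forall x, differentiable f x.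
Hypothesis gL : forall x y, l2norm (grad f x - grad f y) <= L * l2norm (x - y).

Let dotv_grad_line x v c : 0 <= c ->
  `|dotv (grad f (x + c *: v) - grad f x) v| <= c * L * dotv v v.
Proof.
move=> c0; have aux w : dotv (grad f (x + c *: v) - grad f x) w <= c * L * (l2norm v *
  l2norm w).
  apply: le_trans (cauchy_schwarz _ _) _.
  rewrite mulrA ler_wpM2r ?l2norm_ge0// (le_trans (gL _ _))//.
  by rewrite addrC addKr l2normZ ger0_norm// mulrCA mulrA.
have h1 := aux v; have h2 := aux (- v).
rewrite l2normN dotvNr -!expr2 in h1 h2.
by rewrite ler_norml -!sqr_l2norm h1 andbT lerNl.
Qed.

Lemma smooth_ub x v : f (x + v) <= f x + dotv (grad f x) v + L / 2 * dotv v v.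
Proof.
have [c /andP[c0 c1]] := line_MVT x v (- dotv (grad f x) v) (- (L / 2 * dotv v v)) df.
have := dotv_grad_line x v c0; rewrite ler_norml dotvDl dotvNl; lra.
Qed.

Lemma smooth_lb x v : f x + dotv (grad f x) v - L / 2 * dotv v v <= f (x + v).
Proof.
have [c /andP[c0 c1]] := line_MVT x v (- dotv (grad f x) v) (L / 2 * dotv v v) df.
have := dotv_grad_line x v c0; rewrite ler_norml dotvDl dotvNl; lra.
Qed.

Lemma convex_grad x y : convex_function setT f ->
  f x + dotv (grad f x) (y - x) <= f y.
Proof.
move=> cf; rewrite -subr_ge0; apply/ler_addgt0Pr => e e0; rewrite -lerBlDl sub0r lerNl.
pose D := L / 2 * dotv (y - x) (y - x).
(* Convexity on the segment gives f(x + t (y - x)) - f x <= t (f y - f x), and [smooth_lb] loses t^2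
   D; the step is short enough for t D <= e. *)
pose t := Num.min 1 (e / (`|D| + 1)).
have t0 : 0 < t by rewrite lt_min ltr01 divr_gt0// ltr_wpDl.
have t1 : t <= 1 by rewrite ge_min lexx.
have tD : t * D <= e.
  apply: (@le_trans _ _ (e / (`|D| + 1) * (`|D| + 1))); last by rewrite divfK//
    gt_eqF// ltr_wpDl.
  apply: (@le_trans _ _ (t * (`|D| + 1))).
    by rewrite ler_wpM2l ?(ltW t0)// (le_trans (ler_norm _))// lerDl.
  by rewrite ler_wpM2r ?addr_ge0// /t ge_min lexx orbT.
have t01 : (0 <= t)%R && (t <= 1) by rewrite (ltW t0) t1.
have := cf (Itv01 (ltW t0) t1) y x; rewrite !in_setE => /(_ I I).
have := smooth_lb x (t *: (y - x)).
rewrite !dotvZr !dotvZl [X in f X <= _ -> _]/conv /= convRE /= /unstable.onem.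
have -> : x + t *: (y - x) = t *: y + (1 - t) *: x.
  by rewrite scalerBr scalerBl scale1r addrCA.
move=> h1 h2; have {h1 h2} := le_trans h1 h2; move=> h.
rewrite -(ler_pM2l t0).
have : t * (t * D) <= t * e by rewrite ler_pM2l.
rewrite /D; lra.
Qed.

End Smooth.
End Calculus.

(** * Minimizers and strong convexity *)

Section Minimizers.
Context {R : realType}.

Lemma cV_box_compact n (a b : 'I_n -> R) :
  compact [set z : 'cV[R]_n | forall i, a i <= z i 0 <= b i].
Proof.
have -> : [set z : 'cV[R]_n | forall i, a i <= z i 0 <= b i] =
    (fun v : 'rV[R]_n => v^T) @` [set v : 'rV[R]_n | forall i, `[a i, b i]%classic (v
      ord0 i)].
  apply/seteqP; split=> [z zK|_ [v vK <-] i /=].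
    exists z^T; last by rewrite trmxK.
    by move=> i /=; rewrite in_itv/= mxE zK.
  by have := vK i; rewrite /= in_itv/= mxE.
apply: continuous_compact; last first.
  by apply: (@rV_compact R n (fun i => `[a i, b i]%classic)) => i; exact: segment_compact.
apply: continuous_subspaceT => v A /= /(nbhs_ballP v^T) [e e0 eA].
apply/(nbhs_ballP v); exists e => //= w [_ vw]; apply: eA; split=> // i j.
by rewrite !mxE; exact: vw.
Qed.

(** Weierstrass for extended values: the sets of points of a box with phi < a, for a above the
    infimum over the box, generate a filter, which clusters in the compact box; by lower
    semicontinuity phi cannot exceed the infimum at a cluster point. Outside the box z0 is already
    at least as good. *)
Lemma lsc_min n (phi : 'cV[R]_n -> \bar R) z0 r : 0 <= r ->
  lower_semicontinuous phi ->
  (forall z, r < l2norm (z - z0) -> (phi z0 <= phi z)%E) ->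
  exists p, forall w, (phi p <= phi w)%E.
Proof.
move=> r0 lsc far.
pose K := [set z : 'cV[R]_n | forall i, z0 i 0 - r <= z i 0 <= z0 i 0 + r].
have Kz0 : K z0 by move=> i; rewrite lerDl lerBlDr lerDl r0.
have farK z : ~ K z -> (phi z0 <= phi z)%E.
  move=> nKz; apply: far; rewrite ltNge; apply/negP => zr; apply: nKz => i.
  have : (z i 0 - z0 i 0) ^+ 2 <= r ^+ 2.
    rewrite (le_trans _ (dotvv_le zr))// dotvE (bigD1 i)//= !mxE -expr2 lerDl.
    by apply: sumr_ge0 => j _; rewrite -expr2 sqr_ge0.
  by rewrite -[leLHS]real_normK ?num_real// ler_pXn2r ?nnegrE// ler_norml; lra.
pose I := ereal_inf (phi @` K).
have Ile z : K z -> (I <= phi z)%E by move=> Kz; apply: ereal_inf_lbound; exists z.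
suff [p [Kp pI]] : exists p, K p /\ (phi p <= I)%E.
  exists p => w; case: (pselect (K w)) => [Kw|nKw].
    exact: le_trans pI (Ile w Kw).
  exact: le_trans pI (le_trans (Ile _ Kz0) (farK w nKw)).
(* If the infimum is +oo, no level lies above it and the filter would have an empty base. *)
have [Ioo|Inoo] := eqVneq I +oo%E; first by exists z0; rewrite Ioo leey.
pose F := filter_from [set a : \bar R | (I < a)%E] (fun a => [set z | K z /\ (phi z <
  a)%E]).
have FF : ProperFilter F.
  apply: filter_from_proper; last first.
    by move=> a /ereal_inf_lt[_ [z Kz <-] za]; exists z.
  apply: filter_from_filter; first by exists +oo%E; rewrite /= ltey.
  move=> a b Ia Ib; exists (Order.min a b); first by rewrite /= lt_min Ia Ib.
  by move=> z [Kz]; rewrite lt_min => /andP[].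
have FK : F K by exists +oo%E; rewrite /= ?ltey// => z [].
have [p [Kp clp]] := @cV_box_compact n _ _ F FF FK.
exists p; split=> //; rewrite leNgt; apply/negP => Ip.
have [a Ia ap] : exists2 a : R, (I < a%:E)%E & (a%:E < phi p)%E.
  move: Ip; case: (I) => [i| |]; case: (phi p) => [s| |] //.
  - by rewrite lte_fin => ?; exists ((i + s) / 2); rewrite lte_fin; lra.
  - by move=> _; exists (i + 1); rewrite ?ltry// lte_fin; lra.
  - by move=> _; exists (s - 1); rewrite ?ltNyr// lte_fin; lra.
  - by move=> _; exists 0; rewrite ?ltNyr ?ltry.
have [V pV Va] := lsc p a ap.
have Fa : F [set z | K z /\ (phi z < a%:E)%E] by exists a%:E.
by have [z [[_ za] /Va az]] := clp _ _ Fa pV; have := lt_trans za az; rewrite ltxx.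
Qed.

(** [argmin] falls back to 0 without a minimizer, so existence has to be supplied for each proximal
    map. *)
Lemma argmin_le n (phi : 'cV[R]_n -> \bar R) :
  (exists p, forall w, (phi p <= phi w)%E) ->
  forall w, (phi (argmin phi) <= phi w)%E.
Proof.
case=> p pmin; rewrite /argmin.
by have := @xgetPex _ 0 [set z | forall w, (phi z <= phi w)%E] (ex_intro _ p pmin).
Qed.

Lemma lsc_addl n (phi : 'cV[R]_n -> \bar R) (q : 'cV[R]_n -> R) :
  (forall z, phi z != -oo%E) ->
  lower_semicontinuous phi -> continuous q ->
  lower_semicontinuous (fun z => ((q z)%:E + phi z)%E).
Proof.
move=> phiN lsc cq x a ax.
(* The margin above a is shared between phi and q; where phi is +oo, any b above a - q x will do. *)
have [b bphi qb] : exists2 b : R, (b%:E < phi x)%E & a - b < q x.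
  move: ax (phiN x); case: (phi x) => [s| |] //.
    rewrite -EFinD !lte_fin => ? _; exists (s - (q x + s - a) / 2); rewrite ?lte_fin; lra.
  by move=> _ _; exists (a - q x + 1); rewrite ?ltry//; lra.
have [V xV Vb] := lsc x b bphi.
exists (V `&` [set z | a - b < q z]).
  apply: filterI => //.
  have h := cvgr_gt (q x) (cq x); exact: h _ qb.
move=> y [/Vb + /=]; case: (phi y) => [s| |] //.
  by rewrite -EFinD !lte_fin => ? ?; lra.
by move=> _ _; rewrite addey// ltry.
Qed.

Lemma dotv_continuous n (u v : 'cV[R]_n -> 'cV[R]_n) :
  continuous u -> continuous v -> continuous (fun z => dotv (u z) (v z)).
Proof.
move=> cu cv x.
have -> : (fun z => dotv (u z) (v z)) = \sum_i ((fun z => u z i 0) * (fun z => v z i 0)).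
  by apply/funext => z; rewrite dotvE fct_sumE.
elim/big_ind : _ => [|f g cf cg|i _].
- exact: (@cst_continuous _ R^o 0).
- exact: cvgD cf cg.
- apply: (@continuousM R _ _ _ x).
    exact: (continuous_comp (cu x) (@coord_continuous R n 1 i 0 (u x))).
  exact: (continuous_comp (cv x) (@coord_continuous R n 1 i 0 (v x))).
Qed.

Lemma sqdist_continuous n (w : 'cV[R]_n) :
  continuous (fun z : 'cV[R]_n => dotv (z - w) (z - w)).
Proof.
have c : continuous (fun z : 'cV[R]_n => z - w).
  move=> x; apply: (@continuousB R _ _ id (cst w) x); first exact: cvg_id.
  exact: cst_continuous.
exact: dotv_continuous.
Qed.

(* Far away the quadratic term beats any linear lower bound. *)
Lemma coercive_min n (phi : 'cV[R]_n -> \bar R) z0 c b k s :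
  lower_semicontinuous phi -> 0 < c -> phi z0 = s%:E ->
  (forall z, ((c * l2norm (z - z0) ^+ 2 - b * l2norm (z - z0) - k)%:E <= phi z)%E) ->
  exists p, forall w, (phi p <= phi w)%E.
Proof.
move=> lsc c0 z0s lb.
pose r := (`|b| + `|k + s| + c) / c.
have r1 : 1 <= r by rewrite /r ler_pdivlMr// mul1r lerDr addr_ge0.
apply: (lsc_min (z0 := z0) (r := r)) => //; first by apply: le_trans r1.
move=> z rz; rewrite z0s (le_trans _ (lb z))// lee_fin.
set l := l2norm _ in rz *.
have cl : `|b| + `|k + s| <= c * l.
  have : c * r < c * l by rewrite ltr_pM2l.
  by rewrite /r mulrC divfK ?gt_eqF// => ?; lra.
have l1 : 1 <= l by rewrite (le_trans r1)// ltW.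
have := ler_norm b; have := ler_norm (k + s); have := normr_ge0 (k + s).
nra.
Qed.

End Minimizers.

(** * Strong convexity relative to a domain *)

Section StrongConvexity.
Context {R : realType} {n : nat}.
Implicit Types (D : set 'cV[R]_n) (phi psi : 'cV[R]_n -> R) (s : R).

(** Convexity of [D] is part of the notion, so that phi can be the finite part of an extended-valued
    function and [D] its effective domain; s = 0 is plain convexity. *)
Definition sconvex D s phi := forall x y t, D x -> D y -> 0 <= t <= 1 ->
  D (t *: x + (1 - t) *: y) /\
  phi (t *: x + (1 - t) *: y) <=
    t * phi x + (1 - t) * phi y - s / 2 * (t * (1 - t)) * dotv (x - y) (x - y).

Lemma sconvexD D s1 s2 phi psi : sconvex D s1 phi -> sconvex setT s2 psi ->
  sconvex D (s1 + s2) (fun x => psi x + phi x).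
Proof.
move=> c1 c2 x y t Dx Dy t01; have [Dt h1] := c1 _ _ _ Dx Dy t01.
by have [_ h2] := c2 x y t I I t01; split=> //; lra.
Qed.

Lemma sconvex_quad g w (c : R) :
  sconvex setT (2 * c) (fun z => dotv g z + c * dotv (z - w) (z - w)).
Proof.
move=> x y t _ _ _; split=> //.
rewrite !dotvL !(dotvC w) (dotvC y x); lra.
Qed.

Lemma sconvex_min D s phi p : sconvex D s phi -> 0 <= s -> D p ->
  (forall w, D w -> phi p <= phi w) ->
  forall u, D u -> phi p + s / 2 * dotv (u - p) (u - p) <= phi u.
Proof.
move=> cphi s0 Dp pmin u Du; apply/ler_addgt0Pr => e e0.
pose q := s / 2 * dotv (u - p) (u - p).
have q0 : 0 <= q by rewrite mulr_ge0 ?dotvv_ge0//; lra.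
(* Strong convexity between u and p, divided by t, gives phi p + (1 - t) q <= phi u; this t makes
   the loss t q at most e. *)
pose t := e / (q + e).
have qe : 0 < q + e by lra.
have t0 : 0 < t by rewrite divr_gt0.
have t1 : t <= 1 by rewrite /t ler_pdivrMr// mul1r; lra.
have tq : t * q <= e.
  by rewrite /t mulrAC ler_pdivrMr// ler_pM2l//; lra.
have [Dt ht] := cphi u p t Du Dp (introT andP (conj (ltW t0) t1)).
have := le_trans (pmin _ Dt) ht => h.
rewrite -(ler_pM2l t0) -/q.
have : t * (t * q) <= t * e by rewrite ler_pM2l.
rewrite -subr_ge0 in h; rewrite /q; lra.
Qed.

(** Two-point convexity at 1/2 and then at 2 a; this includes a = 1/2, which is tau when m = 1. *)
Lemma sconvex3 D s phi x y z a : sconvex D s phi -> 0 <= s -> 0 <= a -> 2 * a <= 1 ->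
  D x -> D y -> D z ->
  D (a *: x + a *: y + (1 - a - a) *: z) /\
  phi (a *: x + a *: y + (1 - a - a) *: z)
    <= a * phi x + a * phi y + (1 - 2 * a) * phi z.
Proof.
move=> cphi s0 a0 a1 Dx Dy Dz.
have half01 : 0 <= (2^-1 : R) <= 1 by apply/andP; split; lra.
have [Dw hw] := cphi x y 2^-1 Dx Dy half01.
have a01 : 0 <= 2 * a <= 1 by apply/andP; split; lra.
have [Dv hv] := cphi _ z (2 * a) Dw Dz a01.
have e : 2 * a *: (2^-1 *: x + (1 - 2^-1) *: y) + (1 - 2 * a) *: z
    = a *: x + a *: y + (1 - a - a) *: z.
  rewrite scalerDr !scalerA; congr (_ *: _ + _ *: _ + _ *: _); lra.
rewrite e in Dv hv; split=> //.
have n1 := dotvv_ge0 (x - y); have n2 := dotvv_ge0 (2^-1 *: x + (1 - 2^-1) *: y - z).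
apply: le_trans hv _.
set w := _ + _ *: y in hw n2 *.
have : 0 <= s / 2 * (2 * a * (1 - 2 * a)) * dotv (w - z) (w - z).
  rewrite !mulr_ge0//; lra.
have : 0 <= s / 2 * (2^-1 * (1 - 2^-1)) * dotv (x - y) (x - y).
  rewrite !mulr_ge0//; lra.
have : 2 * a * phi w <= 2 * a * (2^-1 * phi x + (1 - 2^-1) * phi y -
       s / 2 * (2^-1 * (1 - 2^-1)) * dotv (x - y) (x - y)).
  by rewrite ler_wpM2l//; lra.
nra.
Qed.

End StrongConvexity.

(** * Resampling of independent draws *)

Section Averages.
Context {R : realType}.

Definition avg (J : finType) (Z : J -> R) : R := #|J|%:R^-1 * \sum_j Z j.

Lemma avg_le (J : finType) (Y Z : J -> R) : (forall j, Y j <= Z j) -> avg Y <= avg Z.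
Proof. by move=> YZ; rewrite ler_wpM2l ?invr_ge0//; exact: ler_sum. Qed.

Lemma eq_avg (J : finType) (Y Z : J -> R) : Y =1 Z -> avg Y = avg Z.
Proof. by move=> YZ; congr (_ * _); apply: eq_bigr. Qed.

Lemma avgD (J : finType) (Y Z : J -> R) : avg (fun j => Y j + Z j) = avg Y + avg Z.
Proof. by rewrite /avg big_split mulrDr. Qed.

Lemma avgZ (J : finType) c (Z : J -> R) : avg (fun j => c * Z j) = c * avg Z.
Proof. by rewrite /avg -mulr_sumr mulrCA. Qed.

Lemma avg_sum (J : finType) (K : Type) (r : seq K) (Z : K -> J -> R) :
  avg (fun j => \sum_(k <- r) Z k j) = \sum_(k <- r) avg (Z k).
Proof. by rewrite /avg exchange_big mulr_sumr. Qed.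

Lemma avg_cst (J : finType) c : (0 < #|J|)%N -> avg (fun _ : J => c) = c.
Proof.
move=> J0; rewrite /avg sumr_const -[c *+ _]mulr_natl mulrA mulVf ?mul1r//.
by rewrite pnatr_eq0 -lt0n.
Qed.

Lemma mean_scale (J : finType) n (eta : J -> 'cV[R]_n) : (0 < #|J|)%N ->
  #|J|%:R *: mean eta = \sum_j eta j.
Proof. by move=> J0; rewrite /mean scalerA mulfV ?scale1r// pnatr_eq0 -lt0n. Qed.

Lemma avg_sqdev (J : finType) n (eta : J -> 'cV[R]_n) : (0 < #|J|)%N ->
  avg (fun j => dotv (eta j - mean eta) (eta j - mean eta))
    <= avg (fun j => dotv (eta j) (eta j)).
Proof.
move=> J0; set c := mean eta.
have -> : avg (fun j => dotv (eta j - c) (eta j - c)) =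
    avg (fun j => dotv (eta j) (eta j)) + (avg (fun j => -2 * dotv c (eta j)) + avg
      (fun _ : J => dotv c c)).
  rewrite -!avgD; apply: eq_avg => j; move: c => c.
  by rewrite !dotvL (dotvC (eta j) c); ring.
rewrite avgZ avg_cst//.
have -> : avg (fun j => dotv c (eta j)) = dotv c c.
  by rewrite {3}/c /mean dotvZr dotv_sumr.
have := dotvv_ge0 c; lra.
Qed.

End Averages.

Section Draws.
Context {R : realType} {I T : finType}.
Local Notation W := {ffun I -> T}.

(* Redraws the coordinates in B. *)
Definition mix (B : pred I) (d d' : W) : W := [ffun i => if B i then d' i else d i].

(** The finite form of measurability with respect to the draws outside [B]. *)
Definition invariant_on (B : pred I) V (X : W -> V) :=
  forall d d' : W, (forall i, ~~ B i -> d i = d' i) -> X d = X d'.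

Lemma invariant_mix B V (X : W -> V) d d' : invariant_on B X -> X (mix B d d') = X d.
Proof. by move=> inv; apply: inv => i /negbTE Bi; rewrite ffunE Bi. Qed.

Lemma invariant_level B (V : eqType) (X : W -> V) v : invariant_on B X ->
  invariant_on B (fun d => d \in [set d' | X d' == v]%SET).
Proof. by move=> inv d d' /inv e; rewrite !inE e. Qed.

(** Exchanging the [B]-coordinates of d and d' is an involution of pairs that preserves membership
    of d in [P]. *)
Lemma resample B (P : {set W}) (Z : W -> R) : invariant_on B (fun d => d \in P) ->
  \sum_(d in P) \sum_(d' : W) Z (mix B d d') = #|{: W}|%:R * \sum_(d in P) Z d.
Proof.
move=> inv.
have -> : #|{: W}|%:R * \sum_(d in P) Z d = \sum_(d in P) \sum_(d' : W) Z d.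
  by rewrite mulr_sumr; apply: eq_bigr => d _; rewrite sumr_const mulr_natl.
rewrite !pair_big_dep /=.
pose sw (p : W * W) := (mix B p.1 p.2, mix B p.2 p.1).
have swK : involutive sw.
  by case=> d d'; congr (_, _); apply/ffunP => i; rewrite !ffunE /=; case: (B i).
rewrite [RHS](reindex_inj (inv_inj swK)); apply: eq_bigl => -[d d'] /=.
by rewrite !andbT (invariant_mix _ _ inv).
Qed.

Hypothesis T0 : (0 < #|T|)%N.

Lemma card_draws_gt0 : (0 < #|{: W}|)%N.
Proof. by rewrite card_ffun expn_gt0 T0. Qed.

(** The tower property: it suffices to bound, for each d, the average over a redraw of the block [B]
    with all other draws frozen. *)
Lemma ler_sum_resample B (P : {set W}) (Y Z : W -> R) :
  invariant_on B (fun d => d \in P) ->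
  (forall d, d \in P -> avg (fun d' => Z (mix B d d')) <= Y d) ->
  \sum_(d in P) Z d <= \sum_(d in P) Y d.
Proof.
move=> inv ZY; have W0 : 0 < #|{: W}|%:R :> R by rewrite ltr0n card_draws_gt0.
rewrite -(ler_pM2l W0) -(resample _ inv) mulr_sumr; apply: ler_sum => d dP.
by rewrite -ler_pdivrMl//; exact: ZY.
Qed.

Lemma avg_resample B (Z : W -> R) :
  avg Z = avg (fun d => avg (fun d' => Z (mix B d d'))).
Proof.
have W0 : #|{: W}|%:R != 0 :> R by rewrite pnatr_eq0 -lt0n card_draws_gt0.
have inv : invariant_on B (fun d : W => d \in [set: W]%SET) by move=> d d' _; rewrite
  !inE.
have := resample Z inv.
have -> (Y : W -> R) : \sum_(d in [set: W]%SET) Y d = \sum_d Y d by apply: eq_bigl =>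
  d; rewrite inE.
have -> (Y : W -> R) : \sum_(d in [set: W]%SET) Y d = \sum_d Y d by apply: eq_bigl =>
  d; rewrite inE.
rewrite /avg -mulr_sumr => ->.
by rewrite mulKf.
Qed.

(** Exchanging the k-th draw of d with an extra element of T is an involution of the pairs (d,
    i). *)
Lemma avg_marginal k (phi : T -> R) : avg (fun d : W => phi (d k)) = avg phi.
Proof.
have W0 : #|{: W}|%:R != 0 :> R by rewrite pnatr_eq0 -lt0n card_draws_gt0.
have Tn0 : #|T|%:R != 0 :> R by rewrite pnatr_eq0 -lt0n.
suff e : #|T|%:R * \sum_(d : W) phi (d k) = #|{: W}|%:R * \sum_i phi i.
  by apply: (mulfI W0); apply: (mulfI Tn0); rewrite /avg mulVKf// e mulrCA mulVKf.
have -> : #|T|%:R * \sum_(d : W) phi (d k) = \sum_(d : W) \sum_(i : T) phi (d k).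
  by rewrite mulr_sumr; apply: eq_bigr => d _; rewrite sumr_const mulr_natl.
have -> : #|{: W}|%:R * \sum_i phi i = \sum_(d : W) \sum_(i : T) phi i.
  by rewrite sumr_const mulr_natl.
rewrite !pair_big_dep /=.
pose sw (p : W * T) := ([ffun i => if i == k then p.2 else p.1 i] : W, p.1 k).
have swK : involutive sw.
  case=> d i; congr (_, _); rewrite ?ffunE ?eqxx//.
  by apply/ffunP => j; rewrite !ffunE /=; case: eqP => // ->.
by rewrite [RHS](reindex_inj (inv_inj swK)).
Qed.

Lemma avg_dotv_indep n k l (xi : T -> 'cV[R]_n) : k != l -> \sum_i xi i = 0 ->
  avg (fun d : W => dotv (xi (d k)) (xi (d l))) = 0.
Proof.
move=> kl xi0; rewrite (avg_resample (pred1 k)).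
rewrite -[RHS](avg_cst 0 card_draws_gt0); apply: eq_avg => d.
rewrite (eq_avg (Z := fun d' : W => dotv (xi (d' k)) (xi (d l)))); last first.
  by move=> d'; rewrite !ffunE /= eqxx eq_sym (negbTE kl).
rewrite (avg_marginal k (fun i => dotv (xi i) (xi (d l)))).
by rewrite /avg -dotv_suml xi0 dotvC dotv0r mulr0.
Qed.

(** Distinct positions carry independent draws of centered vectors, so only the A diagonal terms of
    the double sum survive. *)
Lemma variance_mean n A (iota : 'I_A -> I) (eta : T -> 'cV[R]_n) s : (0 < A)%N ->
  injective iota -> (forall i, dotv (eta i) (eta i) <= s) ->
  avg (fun d : W => dotv (mean (fun k => eta (d (iota k))) - mean eta)
                         (mean (fun k => eta (d (iota k))) - mean eta)) <= s / A%:R.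
Proof.
move=> A0 injI etas.
have An0 : A%:R != 0 :> R by rewrite pnatr_eq0 -lt0n.
pose xi i := eta i - mean eta.
have xi0 : \sum_i xi i = 0.
  by rewrite sumrB sumr_const -[_ *+ #|_|]scaler_nat mean_scale// subrr.
have xis : avg (fun i => dotv (xi i) (xi i)) <= s.
  apply: le_trans (avg_sqdev eta T0) _.
  by rewrite -(avg_cst s T0); exact: avg_le.
rewrite (eq_avg (Z := fun d : W => A%:R^-1 ^+ 2 *
    \sum_(k < A) \sum_(l < A) dotv (xi (d (iota k))) (xi (d (iota l))))); last first.
  move=> d.
  have -> : mean (fun k => eta (d (iota k))) - mean eta = A%:R^-1 *: \sum_k xi (d (iota
    k)).
    rewrite /xi big_split /= sumr_const {1}/mean !card_ord scalerDr; congr (_ + _).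
    by rewrite -[- mean eta *+ A]scaler_nat scalerA mulVf// scale1r.
  rewrite dotvZl dotvZr mulrA -expr2 dotv_suml; congr (_ * _).
  by apply: eq_bigr => k _; rewrite dotv_sumr.
rewrite avgZ avg_sum.
have -> : \sum_(k < A) avg (fun d : W => \sum_(l < A) dotv (xi (d (iota k))) (xi (d
  (iota l))))
    = A%:R * avg (fun i => dotv (xi i) (xi i)).
  rewrite mulr_natl -[in RHS](card_ord A) -sumr_const; apply: eq_bigr => k _.
  rewrite avg_sum (bigD1 k)//= big1 ?addr0.
    by rewrite (avg_marginal (iota k) (fun i => dotv (xi i) (xi i))).
  by move=> l lk; apply: avg_dotv_indep => //; rewrite (inj_eq injI) eq_sym.
rewrite [leLHS](_ : _ = avg (fun i => dotv (xi i) (xi i)) / A%:R); last by field.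
by rewrite ler_wpM2r// invr_ge0.
Qed.

(* [eta] may depend on the draws outside [iota]: this is conditioning on them. *)
Lemma variance_mean_cond n A (iota : 'I_A -> I) (eta : W -> T -> 'cV[R]_n) s :
  (0 < A)%N -> injective iota -> invariant_on (fun i => i \in codom iota) eta ->
  (forall d i, dotv (eta d i) (eta d i) <= s) ->
  avg (fun d : W => dotv (mean (fun k => eta d (d (iota k))) - mean (eta d))
                         (mean (fun k => eta d (d (iota k))) - mean (eta d))) <= s / A%:R.
Proof.
move=> A0 injI inv etas; rewrite (avg_resample (fun i => i \in codom iota)).
rewrite -[leRHS](avg_cst _ card_draws_gt0); apply: avg_le => d.
apply: le_trans (variance_mean A0 injI (etas d)).
rewrite le_eqVlt; apply/orP; left; apply/eqP; apply: eq_avg => d'.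
rewrite (invariant_mix _ _ inv).
have e : (fun k => eta d (mix (fun i => i \in codom iota) d d' (iota k))) =
         (fun k => eta d (d' (iota k))).
  by apply/funext => k; rewrite ffunE codom_f.
by rewrite e.
Qed.

End Draws.

(** * Mean square error of the gradient estimator *)

Section Estimator.
Context {R : realType} {N1 N2 n1 n2 : nat}.
Variables (F : 'I_n1 -> 'cV[R]_N1 -> R) (G : 'I_n2 -> 'cV[R]_N2 -> 'cV[R]_N1).
Variables (L_F B_F L_G B_G L : R).
Hypotheses (n1_gt0 : (0 < n1)%N) (n2_gt0 : (0 < n2)%N).
Hypothesis dF : forall i u, differentiable (F i) u.
Hypothesis dG : forall j x, differentiable (G j) x.
Hypothesis F_smooth : forall i u u', l2norm (grad (F i) u - grad (F i) u') <= L_F *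
  l2norm (u - u').
Hypothesis F_bnd : forall i u, l2norm (grad (F i) u) <= B_F.
Hypothesis G_smooth : forall j x x', opnorm (jac (G j) x - jac (G j) x') <= L_G *
  l2norm (x - x').
Hypothesis G_bnd : forall j x, opnorm (jac (G j) x) <= B_G.
Hypothesis f_smooth : forall i j x y,
     l2norm ((jac (G j) x)^T *m grad (F i) (Gbar G x)
             - (jac (G j) y)^T *m grad (F i) (Gbar G y)) <= L * l2norm (x - y).

Definition gradF u := mean (fun i => grad (F i) u).
Definition jacG x := mean (fun j => jac (G j) x).

Lemma l2norm_gradF u : l2norm (gradF u) <= B_F.
Proof. by apply: l2norm_mean => [|i]; rewrite ?card_ord. Qed.

Lemma gradF_lipschitz u v : l2norm (gradF u - gradF v) <= L_F * l2norm (u - v).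
Proof.
have -> : gradF u - gradF v = mean (fun i => grad (F i) u - grad (F i) v).
  by rewrite /gradF /mean -scalerBr sumrB.
by apply: l2norm_mean => [|i]; rewrite ?card_ord.
Qed.

Lemma B_G_ge0 : 0 <= B_G.
Proof. exact: le_trans (opnorm_ge0 _) (G_bnd (Ordinal n2_gt0) 0). Qed.

Lemma trmx_mean (I : finType) m n (M : I -> 'M[R]_(m, n)) (u : 'cV[R]_m) :
  (mean M)^T *m u = mean (fun i => (M i)^T *m u).
Proof.
by rewrite /mean linearZ /= -scalemxAl linear_sum /= mulmx_suml.
Qed.

Lemma l2norm_jacG x u : l2norm ((jacG x)^T *m u) <= B_G * l2norm u.
Proof.
rewrite trmx_mean; apply: l2norm_mean => [|j]; rewrite ?card_ord//.
by rewrite (le_trans (l2norm_trmulmx _ _))// ler_wpM2r ?l2norm_ge0.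
Qed.

Lemma differentiable_Gbar x : differentiable (Gbar G) x.
Proof. exact: differentiable_mean. Qed.

Lemma differentiable_Fbar u : differentiable (Fbar F) u.
Proof. exact: (@differentiable_mean _ _ _ R F). Qed.

Lemma differentiable_fobj x : differentiable (fobj F G) x.
Proof.
exact: (differentiable_comp (differentiable_Gbar x) (differentiable_Fbar _)).
Qed.

Lemma grad_fobj x : grad (fobj F G) x = (jacG x)^T *m gradF (Gbar G x).
Proof.
have -> : fobj F G = Fbar F \o Gbar G by [].
rewrite grad_comp; [|exact: differentiable_Gbar|exact: differentiable_Fbar].
by rewrite grad_mean// jac_mean.
Qed.

Lemma grad_fobj_lipschitz x y :
  l2norm (grad (fobj F G) x - grad (fobj F G) y) <= L * l2norm (x - y).
Proof.
have e z : grad (fobj F G) z = mean (fun j => mean (fun i => (jac (G j) z)^T *m grad (F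
  i) (Gbar G z))).
  rewrite grad_fobj trmx_mean; congr (mean _); apply/funext => j.
  by rewrite /gradF /mean -scalemxAr mulmx_sumr.
have -> : grad (fobj F G) x - grad (fobj F G) y = mean (fun j => mean (fun i =>
   (jac (G j) x)^T *m grad (F i) (Gbar G x) - (jac (G j) y)^T *m grad (F i) (Gbar G y))).
  rewrite !e /mean -scalerBr -sumrB; congr (_ *: _); apply: eq_bigr => j _.
  by rewrite -scalerBr -sumrB.
apply: l2norm_mean => [|j]; rewrite ?card_ord//.
by apply: l2norm_mean => [|i]; rewrite ?card_ord.
Qed.

Lemma fobj_lipschitz x y : fobj F G x - fobj F G y <= B_G * B_F * l2norm (x - y).
Proof.
apply: lipschitz_grad => z; first exact: differentiable_fobj.
rewrite grad_fobj (le_trans (l2norm_jacG _ _))// ler_wpM2l ?B_G_ge0//.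
exact: l2norm_gradF.
Qed.

Lemma dotvv_add n (u v : 'cV[R]_n) : dotv (u + v) (u + v) <= 2 * dotv u u + 2 * dotv v v.
Proof. have := dotvv_ge0 (u - v); rewrite !dotvL (dotvC v u); lra. Qed.

Context {I : finType} {A B : nat}.
Variables (iA : 'I_A -> I) (iB : 'I_B -> I) (x xt : 'cV[R]_N2).
Hypotheses (A0 : (0 < A)%N) (B0 : (0 < B)%N).
Hypotheses (injA : injective iA) (injB : injective iB) (iAB : forall k l, iA k != iB l).

Definition estimator_at (a : 'I_A -> 'I_n2) (b : 'I_B -> 'I_n2) :=
  (mean (fun k => jac (G (b k)) x - jac (G (b k)) xt) + jacG xt)^T
    *m gradF (mean (fun k => G (a k) x - G (a k) xt) + Gbar G xt).

Definition estimator (d : {ffun I -> 'I_n2}) := estimator_at (d \o iA) (d \o iB).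

Lemma estimator_ext (d d' : {ffun I -> 'I_n2}) : (forall k, d (iA k) = d' (iA k)) ->
  (forall k, d (iB k) = d' (iB k)) -> estimator d = estimator d'.
Proof.
move=> eA eB; rewrite /estimator.
have -> : d \o iA = d' \o iA by apply/funext => k; exact: eA.
by have -> : d \o iB = d' \o iB by apply/funext => k; exact: eB.
Qed.

(** The factor 2 separates the Jacobian error [a] from the effect of the error [b] of the sampled
    value of G. In B_G^4, one B_G^2 comes from the Jacobian at x, through which [b] is transported,
    and one from the Lipschitz constant of G, which bounds the variance. *)
Lemma estimator_mse :
  avg (fun d => dotv (estimator d - grad (fobj F G) x) (estimator d - grad (fobj F G) x))
  <= 2 * (B_F ^+ 2 * L_G ^+ 2 / B%:R + B_G ^+ 4 * L_F ^+ 2 / A%:R)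
     * dotv (x - xt) (x - xt).
Proof.
pose eta j := G j x - G j xt.
pose M j := jac (G j) x - jac (G j) xt.
pose v (d : {ffun I -> 'I_n2}) := gradF (mean (fun k => eta (d (iA k))) + Gbar G xt).
pose a (d : {ffun I -> 'I_n2}) := mean (fun k => (M (d (iB k)))^T *m v d) - mean (fun j
  => (M j)^T *m v d).
pose b (d : {ffun I -> 'I_n2}) := mean (fun k => eta (d (iA k))) - mean eta.
have T0 : (0 < #|'I_n2|)%N by rewrite card_ord.
have trD (P Q : 'M[R]_(N1, N2)) : (P + Q)^T = P^T + Q^T by rewrite linearD.
have trB (P Q : 'M[R]_(N1, N2)) : P^T - Q^T = (P - Q)^T by rewrite linearB.
have eJ : - mean M + jacG x = jacG xt.
  by rewrite /jacG /M /mean sumrB scalerBr opprB subrK.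
have ve d : estimator d - grad (fobj F G) x
    = a d + (jacG x)^T *m (v d - gradF (Gbar G x)).
  rewrite /a -!trmx_mean grad_fobj mulmxBr addrA; congr (_ - _).
  rewrite /estimator /estimator_at -/(v d) -mulmxBl -mulmxDl; congr (_ *m _).
  by rewrite trB -trD -addrA eJ.
have L0 := l2norm_ge0 (x - xt).
have bb d : dotv ((jacG x)^T *m (v d - gradF (Gbar G x))) ((jacG x)^T *m (v d - gradF
  (Gbar G x)))
    <= B_G ^+ 2 * L_F ^+ 2 * dotv (b d) (b d).
  apply: le_trans (dotvv_le (l2norm_jacG _ _)) _.
  rewrite exprMn -mulrA ler_wpM2l ?sqr_ge0// sqr_l2norm -sqr_l2norm.
  rewrite [leRHS](_ : _ = (L_F * l2norm (b d)) ^+ 2); last by rewrite exprMn sqr_l2norm.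
  rewrite sqr_l2norm; apply: dotvv_le.
  have -> : b d = mean (fun k => eta (d (iA k))) + Gbar G xt - Gbar G x.
    rewrite /b -addrA; congr (_ + _).
    by rewrite /eta /mean sumrB scalerBr opprB /Gbar card_ord.
  exact: gradF_lipschitz.
(* The vector v reads only the A-draws, whose positions are disjoint from those being redrawn. *)
have inv : invariant_on (fun i => i \in codom iB) (fun d j => (M j)^T *m v d).
  move=> d d' dd'; suff vE : v d = v d' by rewrite vE.
  suff e : (fun k => eta (d (iA k))) = (fun k => eta (d' (iA k))) by rewrite /v e.
  apply/funext => k; rewrite dd'//.
  by apply/codomP => -[l]; apply/eqP; exact: iAB.
have Mv d j : dotv ((M j)^T *m v d) ((M j)^T *m v d) <= (L_G * l2norm (x - xt) * B_F)
  ^+ 2.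
  apply: dotvv_le; apply: le_trans (l2norm_trmulmx _ _) _.
  by apply: ler_pM; [exact: opnorm_ge0|exact: l2norm_ge0|exact: G_smooth|exact:
    l2norm_gradF].
have ha : avg (fun d => dotv (a d) (a d)) <= (L_G * l2norm (x - xt) * B_F) ^+ 2 / B%:R.
  exact: (variance_mean_cond T0 B0 injB inv Mv).
have etas j : dotv (eta j) (eta j) <= (B_G * l2norm (x - xt)) ^+ 2.
  by apply: dotvv_le; exact: lipschitz_jac.
have hb : avg (fun d => dotv (b d) (b d)) <= (B_G * l2norm (x - xt)) ^+ 2 / A%:R.
  exact: (variance_mean T0 A0 injA etas).
apply: (@le_trans _ _ (avg (fun d => 2 * dotv (a d) (a d) + 2 * (B_G ^+ 2 * L_F ^+ 2) *
  dotv (b d) (b d)))).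
  apply: avg_le => d; rewrite ve (le_trans (dotvv_add _ _))// lerD2l.
  by have := bb d; lra.
rewrite avgD !avgZ.
have h : B_G ^+ 2 * L_F ^+ 2 * avg (fun d => dotv (b d) (b d)) <=
   B_G ^+ 2 * L_F ^+ 2 * ((B_G * l2norm (x - xt)) ^+ 2 / A%:R).
  by rewrite ler_wpM2l// mulr_ge0// sqr_ge0.
rewrite -sqr_l2norm.
rewrite !exprMn in ha h; lra.
Qed.

End Estimator.

(** * One step and one epoch of the accelerated method *)

Section Jensen.
Context {R : realType} {n : nat}.

Lemma sconvex_jensen (D : set 'cV[R]_n) s (phi : 'cV[R]_n -> R) k (a : nat -> R) (y :
  nat -> 'cV[R]_n) :
  sconvex D s phi -> 0 <= s -> (forall i, 0 < a i) -> (forall i, (i <= k)%N -> D (y i)) ->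
  let c := \sum_(i < k.+1) a i in let p := c^-1 *: \sum_(i < k.+1) a i *: y i in
  D p /\ c * phi p <= \sum_(i < k.+1) a i * phi (y i).
Proof.
move=> cphi s0 a0; elim: k => [|k IH] Dy /=.
  rewrite !big_ord_recl !big_ord0 !addr0 scalerA mulVf ?gt_eqF// scale1r.
  by split; [exact: Dy|].
have [|Dp hp] := IH; first by move=> i ik; apply: Dy; exact: leqW.
rewrite /= in Dp hp.
rewrite big_ord_recr [X in _ *: X]big_ord_recr [X in _ /\ (_ <= X)]big_ord_recr /=.
set c := \sum_(i < k.+1) a i in Dp hp *.
set w := \sum_(i < k.+1) a i *: y i in Dp hp *.
have c0 : 0 < c by rewrite /c big_ord_recl ltr_wpDr// sumr_ge0// => i _; exact: ltW.
have ak0 := a0 k.+1.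
(* The partial average, of total weight c, is combined with the new point; the domain is known to be
   stable under two-point combinations, so membership is carried through the induction. *)
pose t := c / (c + a k.+1).
have ca0 : 0 < c + a k.+1 by lra.
have t01 : 0 <= t <= 1.
  by apply/andP; split; [exact: ltW (divr_gt0 c0 ca0)|rewrite /t ler_pdivrMr// mul1r
    lerDl ltW].
have [Dt ht] := cphi _ _ t Dp (Dy k.+1 (leqnn _)) t01.
have e : t *: (c^-1 *: w) + (1 - t) *: y k.+1 = (c + a k.+1)^-1 *: (w + a k.+1 *: y k.+1).
  rewrite scalerDr !scalerA; congr (_ *: _ + _ *: _); rewrite /t; field; rewrite
    ?gt_eqF//.
rewrite e in Dt ht; split=> //.
set p := _ *: (w + _) in Dt ht *.
have tca : (c + a k.+1) * t = c by rewrite /t mulrC divfK// gt_eqF.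
have : (c + a k.+1) * phi p <= (c + a k.+1) * (t * phi (c^-1 *: w) + (1 - t) * phi (y
  k.+1)).
  rewrite ler_pM2l// (le_trans ht)// lerBlDr lerDl.
  case/andP: t01 => t0 t1; apply: mulr_ge0 (dotvv_ge0 _).
  have t1' : 0 <= 1 - t by lra.
  exact: mulr_ge0 (divr_ge0 s0 (ler0n R 2)) (mulr_ge0 t0 t1').
move/le_trans; apply.
have -> : (c + a k.+1) * (t * phi (c^-1 *: w) + (1 - t) * phi (y k.+1))
  = (c + a k.+1) * t * phi (c^-1 *: w) + (c + a k.+1 - (c + a k.+1) * t) * phi (y k.+1)
    by ring.
rewrite tca; lra.
Qed.

End Jensen.

Section KatyushaStep.
Context {R : realType} {n : nat}.
Variables (f hr : 'cV[R]_n -> R) (D : set 'cV[R]_n) (L mu tau : R).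
Hypothesis df : forall x, differentiable f x.
Hypothesis gL : forall x y, l2norm (grad f x - grad f y) <= L * l2norm (x - y).
Hypothesis cf : convex_function setT f.
Hypothesis chr : sconvex D mu hr.
Hypotheses (mu0 : 0 < mu) (L0 : 0 < L) (tau0 : 0 < tau) (tau1 : 2 * tau <= 1).
Let H x := f x + hr x.
Variables (y z xt u : 'cV[R]_n).
Hypotheses (Dy : D y) (Dz : D z) (Dxt : D xt) (Du : D u).
Let x := tau *: z + tau *: xt + (1 - tau - tau) *: y.

Lemma sconvex_convex : sconvex setT 0 f.
Proof.
move=> a b t _ _ t01; split=> //.
have /andP[t0 t1] := t01.
have := @cf (Itv01 t0 t1) a b; rewrite !in_setE => /(_ I I).
rewrite [X in f X <= _ -> _]/conv /= convRE /= /unstable.onem => h.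
apply: le_trans h _; lra.
Qed.

(** The competitor in the y-step is v = tau z' + tau xt + (1 - 2 tau) y, for which v - x = tau (z' -
    z): its quadratic cost is exactly tau times that of z' in the z-step, and the two cancel after
    weighting the z-step by tau. *)
Lemma katyusha_step (g z' y' : 'cV[R]_n) : D z' -> D y' ->
  (forall w, D w -> dotv g z' + 3 * tau * L / 2 * dotv (z' - z) (z' - z) + hr z'
                 <= dotv g w + 3 * tau * L / 2 * dotv (w - z) (w - z) + hr w) ->
  (forall w, D w -> dotv g y' + 3 * L / 2 * dotv (y' - x) (y' - x) + hr y'
                 <= dotv g w + 3 * L / 2 * dotv (w - x) (w - x) + hr w) ->
  (H y' - H u) + tau * (3 * tau * L / 2 + mu / 2) * dotv (u - z') (u - z')
  <= tau * (H xt - H u) + (1 - 2 * tau) * (H y - H u)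
     + tau * (3 * tau * L / 2 + mu / 8) * dotv (u - z) (u - z)
     + (2 * tau / mu + (4 * L)^-1) * dotv (g - grad f x) (g - grad f x).
Proof.
move=> Dz' Dy' zmin ymin.
move: (mu0) (L0) (tau0) (tau1) => mu_gt0 L_gt0 tau_gt0 tau_le.
have cz : sconvex D (mu + 2 * (3 * tau * L / 2))
    (fun w => dotv g w + 3 * tau * L / 2 * dotv (w - z) (w - z) + hr w).
  exact: sconvexD chr (sconvex_quad _ _ _).
have tL := mulr_gt0 tau0 L0.
have s0 : 0 <= mu + 2 * (3 * tau * L / 2) by lra.
have hz := sconvex_min cz s0 Dz' zmin Du.
have [Dv hv] := sconvex3 chr (ltW mu0) (ltW tau0) tau1 Dz' Dxt Dy.
have := ymin _ Dv.
set v := _ + _ in Dv hv *.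
have vx : v - x = tau *: (z' - z) by apply/colP => i; rewrite !mxE; ring.
rewrite vx dotvZl dotvZr.
have hf := smooth_ub df gL x (y' - x); rewrite subrKC in hf.
have fu := convex_grad df gL x u cf.
have fxt := convex_grad df gL x xt cf.
have fy := convex_grad df gL x y cf.
(* This parameter leaves L |y' - x|^2, which with the L/2 from smoothness uses up the 3L/2 of the
   y-step. *)
have i4L : 0 < (2 * L)^-1 by rewrite invr_gt0 mulr_gt0.
have yg1 := young (g - grad f x) (- (y' - x)) i4L.
(* This one leaves (mu/8) |u - z|^2, a quarter of the mu/2 that strong convexity yields in the
   z-step. *)
have imu : 0 < 4 / mu by rewrite divr_gt0.
have yg2 := young (g - grad f x) (u - z) imu.
have gv : dotv g v = dotv g x + tau * dotv g z' - tau * dotv g z.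
  by rewrite -(subrK x v) vx !dotvL; ring.
have gradx : dotv (grad f x) x = tau * dotv (grad f x) z + tau * dotv (grad f x) xt
    + (1 - tau - tau) * dotv (grad f x) y.
  by rewrite {2}/x !dotvDr !dotvZr.
rewrite gv.
rewrite [dotv (- (y' - x)) _]dotvNl !dotvNr opprK in yg1.
move: hf fu fxt fy yg1 yg2 hz hv gradx; rewrite /H.
move: (dotv (y' - x) (y' - x)) (dotv (z' - z) (z' - z)) (dotv (u - z) (u - z))
  (dotv (u - z') (u - z')) (dotv (g - grad f x) (g - grad f x)) => qy qz qu qu' qe.
rewrite !(dotvDl, dotvDr, dotvNl, dotvNr).
have -> : (4 / mu)^-1 / 2 = mu / 8 by field; rewrite gt_eqF.
have -> : (2 * L)^-1^-1 / 2 = L by field; rewrite gt_eqF.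
have -> : (2 * L)^-1 / 2 = (4 * L)^-1 by field; rewrite gt_eqF.
have -> : 4 / mu / 2 = 2 / mu by field; rewrite gt_eqF.
have -> : 2 * tau / mu = tau * (2 / mu) by rewrite mulrA [2 * tau]mulrC.
move: (2 / mu) ((4 * L)^-1) => im iL hf fu fxt fy yg1 yg2 hz hv gradx hy.
have fu' := ler_wpM2l (ltW tau0) fu.
have fxt' := ler_wpM2l (ltW tau0) fxt.
have tau1' : 0 <= 1 - 2 * tau by lra.
have fy' := ler_wpM2l tau1' fy.
have yg2' := ler_wpM2l (ltW tau0) yg2.
have hz' := ler_wpM2l (ltW tau0) hz.
lra.
Qed.

Hypothesis umin : forall w, D w -> H u <= H w.
Hypothesis muL : mu <= 2 * L * tau.

Lemma sconvex_H : sconvex D mu H.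
Proof.
have -> : mu = mu + 0 by rewrite addr0.
by apply: sconvexD chr _; exact: sconvex_convex.
Qed.

Lemma dist_min w : D w -> dotv (u - w) (u - w) <= 2 / mu * (H w - H u).
Proof.
move: (mu0) => mu_gt0.
move=> Dw; have := sconvex_min sconvex_H (ltW mu0) Du umin Dw.
have -> : dotv (w - u) (w - u) = dotv (u - w) (u - w).
  by rewrite -opprB dotvNl dotvNr opprK.
by move=> h; rewrite mulrAC ler_pdivlMr//; lra.
Qed.

(** The vector x - xt combines u - z, u - y and u - xt with coefficients of absolute sum 2 - 2 tau,
    so convexity of the square leaves weights at most 2 tau, 2 and 2; quadratic growth pays for the
    last two. *)
Lemma dist_snapshot : dotv (x - xt) (x - xt) <=
  2 * tau * dotv (u - z) (u - z) + 4 / mu * ((H y - H u) + (H xt - H u)).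
Proof.
move: (mu0) (L0) (tau0) (tau1) => mu_gt0 L_gt0 tau_gt0 tau_le.
have hy := dist_min Dy; have hxt := dist_min Dxt.
have -> : 4 / mu = 2 * (2 / mu) by rewrite mulrA; congr (_ / _); ring.
suff : dotv (x - xt) (x - xt) <= 2 * tau * dotv (u - z) (u - z)
  + 2 * dotv (u - y) (u - y) + 2 * dotv (u - xt) (u - xt) by lra.
have e : x - xt = - (tau *: (u - z) + (1 - 2 * tau) *: (u - y) - (1 - tau) *: (u - xt)).
  by apply/colP => i; rewrite !mxE; ring.
rewrite e dotvNl dotvNr opprK.
move: (u - z) (u - y) (u - xt) => a b c.
have ab := dotvv_ge0 (a - b); have ac := dotvv_ge0 (a + c); have bc := dotvv_ge0 (b + c).
have aa := dotvv_ge0 a; have bb := dotvv_ge0 b; have cc := dotvv_ge0 c.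
rewrite !dotvL (dotvC b a) (dotvC c a) (dotvC c b) in ab ac bc *.
have t1 : 0 <= tau * (1 - 2 * tau) by apply: mulr_ge0; lra.
have t2 : 0 <= tau * (1 - tau) by apply: mulr_ge0; lra.
have t3 : 0 <= (1 - 2 * tau) * (1 - tau) by apply: mulr_ge0; lra.
have h1 := mulr_ge0 t1 ab; have h2 := mulr_ge0 t2 ac; have h3 := mulr_ge0 t3 bc.
have h4 := mulr_ge0 (ltW tau0) aa; have h5 := mulr_ge0 (ltW tau0) bb; have h6 :=
  mulr_ge0 (ltW tau0) cc.
have h7 := mulr_ge0 (mulr_ge0 (ltW tau0) (ltW tau0)) aa.
have h8 := mulr_ge0 (mulr_ge0 (ltW tau0) (ltW tau0)) bb.
have h9 := mulr_ge0 (mulr_ge0 (ltW tau0) (ltW tau0)) cc.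
nra.
Qed.

(** The coefficient of |x - xt|^2 is at most tau mu/90 + tau mu/360 = tau mu/72, the second part by
    mu <= 2 L tau. Through [dist_snapshot] it becomes tau/18 on both gaps and, as 2 tau <= 1, tau
    mu/72 on |u - z|^2: hence 19/18 = 1 + 1/18 and 5/36 = 1/8 + 1/72. *)
Lemma katyusha_error (e2 : R) : e2 <= mu ^+ 2 / 180 * dotv (x - xt) (x - xt) ->
  tau * (H xt - H u) + (1 - 2 * tau) * (H y - H u)
     + tau * (3 * tau * L / 2 + mu / 8) * dotv (u - z) (u - z)
     + (2 * tau / mu + (4 * L)^-1) * e2
  <= tau * (19 / 18) * (H xt - H u) + (1 - 2 * tau + tau / 18) * (H y - H u)
     + tau * (3 * tau * L / 2 + 5 / 36 * mu) * dotv (u - z) (u - z).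
Proof.
move: (mu0) (L0) (tau0) (tau1) => mu_gt0 L_gt0 tau_gt0 tau_le.
move: (muL) => muL_le he.
have qd := dist_snapshot; have zz := dotvv_ge0 (u - z).
have dd := dotvv_ge0 (x - xt).
have c0 : 0 <= 2 * tau / mu + (4 * L)^-1.
  by rewrite addr_ge0// ?divr_ge0 ?invr_ge0//; lra.
have := ler_wpM2l c0 he.
have iL : (4 * L)^-1 * (mu ^+ 2 / 180) <= mu * tau / 360.
  rewrite mulrC ler_pdivrMr; last lra.
  have := ler_wpM2l (ltW mu0) muL; nra.
have h1 : (2 * tau / mu + (4 * L)^-1) * (mu ^+ 2 / 180 * dotv (x - xt) (x - xt))
    <= tau * mu / 72 * dotv (x - xt) (x - xt).
  rewrite mulrA ler_wpM2r// mulrDl.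
  have -> : 2 * tau / mu * (mu ^+ 2 / 180) = tau * mu / 90 by field; rewrite gt_eqF.
  lra.
have tm : 0 <= tau * mu / 72 by rewrite divr_ge0// mulr_ge0// ltW.
have := ler_wpM2l tm qd.
have -> : tau * mu / 72 * (2 * tau * dotv (u - z) (u - z) + 4 / mu * (H y - H u + (H xt
  - H u)))
  = tau * mu / 72 * (2 * tau) * dotv (u - z) (u - z) + tau / 18 * (H y - H u + (H xt -
    H u)).
  by field; rewrite gt_eqF.
have h2 : tau * mu / 72 * (2 * tau) * dotv (u - z) (u - z) <= tau * mu / 72 * dotv (u -
  z) (u - z).
  by rewrite ler_wpM2r// ler_piMr.
lra.
Qed.

End KatyushaStep.

Lemma bernoulli {R : realType} (t : R) k : 0 <= t -> 1 + k%:R * t <= (1 + t) ^+ k.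
Proof.
move=> t0; elim: k => [|k IH]; first by rewrite mul0r addr0 expr0.
have t10 : 0 <= 1 + t by lra.
have := ler_wpM2l t10 IH; rewrite exprS -natr1.
have : 0 <= k%:R * t * t by rewrite !mulr_ge0.
lra.
Qed.

(** * Telescoping over one epoch *)

Section Telescoping.
Context {R : realType}.
Variables (m : nat) (L mu : R) (p zt : nat -> R) (q : R).
Hypotheses (m0 : (0 < m)%N) (mu0 : 0 < mu) (L0 : 0 < L).
Let tau : R := (2 * m%:R)^-1.
Let theta : R := 1 + (12 * m%:R)^-1.
Let K := tau * (3 * tau * L / 2 + 5 / 36 * mu).
Let rho := 1 - 2 * tau + tau / 18.
Let Theta := \sum_(j < m) theta ^+ j.
Hypothesis tauL : tau ^+ 2 * L <= mu.
Hypothesis p0 : forall j, 0 <= p j.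
Hypothesis z0 : forall j, 0 <= zt j.
Hypothesis step : forall j, (j < m)%N ->
  p j.+1 + tau * (3 * tau * L / 2 + mu / 2) * zt j.+1
    <= tau * (19 / 18) * q + rho * p j + K * zt j.

Lemma theta_tau : theta = 1 + tau / 6.
Proof. by rewrite /theta /tau; field; rewrite pnatr_eq0 -lt0n. Qed.

Lemma tau_bnd : 0 < tau /\ 2 * tau <= 1.
Proof.
have m1 : (1 : R) <= m%:R by rewrite ler1n.
split; first by rewrite invr_gt0; lra.
rewrite /tau invfM mulrA mulfV ?mul1r ?invf_le1//; lra.
Qed.

Lemma theta_pow : 13 / 12 <= theta ^+ m.
Proof.
have [t0 _] := tau_bnd; rewrite theta_tau.
have t60 : 0 <= tau / 6 by lra.
apply: le_trans (bernoulli m t60); rewrite /tau.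
have m00 : m%:R != 0 :> R by rewrite pnatr_eq0 -lt0n.
have -> : m%:R * ((2 * m%:R)^-1 / 6) = 12^-1 :> R by field.
lra.
Qed.

(** The weight 16/9 is the one for which tau 16/9 + theta rho <= 1, so that each theta^j p_(j+1)
    pays both for its share of the average and for the next state. The conclusion only asks for
    (13/12) (19/18) < 16/9 and theta^m >= 13/12. *)
Lemma epoch_telescope :
  13 / 12 * (tau * (19 / 18) * \sum_(j < m) theta ^+ j * p j.+1 + rho * p m + K * zt m)
  <= tau * (19 / 18) * Theta * q + rho * p 0 + K * zt 0.
Proof.
have [t0 t1] := tau_bnd; move: (mu0) (L0) (tauL) => mu_gt0 L_gt0 tauL_le.
have K0 : 0 <= K by rewrite /K mulr_ge0 ?addr_ge0// ?mulr_ge0//; lra.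
have th0 : 0 < theta by rewrite theta_tau; lra.
have rho0 : 0 <= rho by rewrite /rho; lra.
(* The factor theta = 1 + tau/6 adds mu/4 at most to the L-term, by tau^2 L <= mu, and little to
   5/36 mu; the sum stays below the mu/2 of the step. *)
have K1 : theta * K <= tau * (3 * tau * L / 2 + mu / 2).
  rewrite theta_tau /K mulrCA ler_pM2l//.
  have : tau * mu <= mu / 2 by nra.
  have : tau * (tau * L) <= mu by rewrite mulrA -expr2.
  nra.
have ind j : (j <= m)%N ->
   tau * (16 / 9) * (\sum_(i < j) theta ^+ i * p i.+1) + theta ^+ j * (rho * p j + K *
     zt j)
   <= tau * (19 / 18) * (\sum_(i < j) theta ^+ i) * q + rho * p 0 + K * zt 0.
  elim: j => [_|j IH jm]; first by rewrite !big_ord0 expr0 mul1r !mulr0 mul0r !add0r.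
  have {IH} := IH (ltnW jm); rewrite !big_ord_recr /= exprS.
  have tj : 0 <= theta ^+ j by rewrite exprn_ge0// ltW.
  have := ler_wpM2l tj (step jm).
  have : theta ^+ j * ((tau * (16 / 9) + theta * rho) * p j.+1) <= theta ^+ j * p j.+1.
    rewrite ler_wpM2l// ler_piMl// theta_tau /rho; nra.
  have : theta ^+ j * (theta * K * zt j.+1) <= theta ^+ j * (tau * (3 * tau * L / 2 +
    mu / 2) * zt j.+1).
    by rewrite ler_wpM2l// ler_wpM2r.
  lra.
apply: le_trans (ind m (leqnn _)).
have Sg0 : 0 <= \sum_(j < m) theta ^+ j * p j.+1.
  by apply: sumr_ge0 => j _; rewrite mulr_ge0// exprn_ge0// ltW.
have tS : 0 <= tau * \sum_(j < m) theta ^+ j * p j.+1 by rewrite mulr_ge0// ltW.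
have e0 : 0 <= rho * p m + K * zt m by rewrite addr_ge0// mulr_ge0.
have := ler_wpM2r e0 theta_pow.
lra.
Qed.

End Telescoping.

(** * Consequences of the rounded parameters of SoCK *)

Section SockConstants.
Context {R : realType}.

Lemma le_nceil (x : R) : 0 <= x -> x <= (nceil x)%:R.
Proof.
move=> x0; have c0 : 0 <= Num.ceil x by rewrite ceil_ge0// (lt_le_trans _ x0)// ltrN10.
by rewrite /nceil natr_absz ger0_norm// ceil_ge.
Qed.

Lemma nceil_lt (x : R) : 0 <= x -> (nceil x)%:R < x + 1.
Proof.
move=> x0; have c0 : 0 <= Num.ceil x by rewrite ceil_ge0// (lt_le_trans _ x0)// ltrN10.
by rewrite /nceil natr_absz ger0_norm// -ltrBlDr ltrBlDr; have := ceilB1_lt x; rewrite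
  intrB ltrBlDr.
Qed.

Lemma le_max1_nceil (x : R) : 0 <= x -> x <= (maxn 1 (nceil x))%:R.
Proof. by move=> x0; rewrite (le_trans (le_nceil x0))// ler_nat leq_maxr. Qed.

Variables (L mu : R).
Hypotheses (mu0 : 0 < mu) (muL : mu <= L).
Let s := Num.sqrt (L / mu).
Let m := sock_m L mu.

Let s_ge1 : 1 <= s.
Proof. by rewrite -sqrtr1 ler_wsqrtr// ler_pdivlMr// mul1r. Qed.

Let s2 : s ^+ 2 = L / mu.
Proof. by rewrite sqr_sqrtr// divr_ge0 ?(ltW mu0)// (le_trans (ltW mu0)). Qed.

Let half_le : 2^-1 * s <= m%:R.
Proof. by apply: le_nceil; rewrite mulr_ge0// sqrtr_ge0. Qed.

Lemma sock_m_gt0 : (0 < m)%N.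
Proof. by rewrite -(ltr0n R) (lt_le_trans _ half_le)// mulr_gt0// (lt_le_trans _
  s_ge1). Qed.

(** For m >= 2, rounding up gives m - 1 < s/2 and thus m <= s; for m = 1 the bound is s >= 1, which
    is where mu <= L enters. *)
Lemma sock_m_le : m%:R <= s.
Proof.
move: (s_ge1) => s1.
have : m%:R < 2^-1 * s + 1 :> R by apply: nceil_lt; rewrite mulr_ge0// sqrtr_ge0.
have := sock_m_gt0; case: (m) => [//|[|k]] _; first by move=> _; exact: s1.
have k0 : (0 : R) <= k%:R by [].
have -> : k.+2%:R = k%:R + 2 :> R by rewrite -addn2 natrD.
by move: s1; move: (s) => s'; lra.
Qed.

Lemma sock_tauL : (2 * m%:R)^-1 ^+ 2 * L <= mu.
Proof.
have m0 : (0 : R) < m%:R by rewrite ltr0n sock_m_gt0.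
have -> : L = s ^+ 2 * mu by rewrite s2 divfK// gt_eqF.
rewrite mulrA ler_piMl ?(ltW mu0)// -exprMn exprn_ile1 ?mulr_ge0 ?invr_ge0 ?mulr_ge0
  ?sqrtr_ge0//.
rewrite ler_pdivrMl ?mulr_gt0// mulr1; move: (half_le); move: (s) => s'; lra.
Qed.

Lemma sock_mu_le : mu <= 2 * L * (2 * m%:R)^-1.
Proof.
have m0 : (0 : R) < m%:R by rewrite ltr0n sock_m_gt0.
have -> : 2 * L * (2 * m%:R)^-1 = L / m%:R by field; rewrite gt_eqF.
rewrite ler_pdivlMr// mulrC -ler_pdivlMr// -s2 (le_trans sock_m_le)// expr2.
by rewrite ler_peMl// (le_trans ler01).
Qed.

Lemma sock_A_bnd B_G L_F : B_G ^+ 4 * L_F ^+ 2 / (sock_A L_F B_G mu)%:R <= mu ^+ 2 / 720.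
Proof.
have A0 : (0 : R) < (sock_A L_F B_G mu)%:R by rewrite ltr0n leq_maxl.
rewrite ler_pdivrMr//.
have B4 : 0 <= B_G ^+ 4 by rewrite (_ : 4 = 2 * 2)%N// exprM sqr_ge0.
have h : 720 * B_G ^+ 4 * L_F ^+ 2 / mu ^+ 2 <= (sock_A L_F B_G mu)%:R.
  have a0 : 0 <= 720 * B_G ^+ 4 * L_F ^+ 2 / mu ^+ 2.
    exact: divr_ge0 (mulr_ge0 (mulr_ge0 (ler0n R 720) B4) (sqr_ge0 _)) (sqr_ge0 _).
  exact: le_max1_nceil a0.
rewrite ler_pdivrMr ?exprn_gt0// in h; lra.
Qed.

Lemma sock_B_bnd B_F L_G : B_F ^+ 2 * L_G ^+ 2 / (sock_B B_F L_G mu)%:R <= mu ^+ 2 / 720.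
Proof.
have A0 : (0 : R) < (sock_B B_F L_G mu)%:R by rewrite ltr0n leq_maxl.
rewrite ler_pdivrMr//.
have h : 720 * B_F ^+ 2 * L_G ^+ 2 / mu ^+ 2 <= (sock_B B_F L_G mu)%:R.
  have a0 : 0 <= 720 * B_F ^+ 2 * L_G ^+ 2 / mu ^+ 2.
    exact: divr_ge0 (mulr_ge0 (mulr_ge0 (ler0n R 720) (sqr_ge0 _)) (sqr_ge0 _))
      (sqr_ge0 _).
  exact: le_max1_nceil a0.
rewrite ler_pdivrMr ?exprn_gt0// in h; lra.
Qed.

End SockConstants.

(** * One step averaged over its own draws *)

Section RandomStep.
Context {R : realType} {N1 N2 n1 n2 : nat}.
Variables (F : 'I_n1 -> 'cV[R]_N1 -> R) (G : 'I_n2 -> 'cV[R]_N2 -> 'cV[R]_N1).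
Variables (L_F B_F L_G B_G L : R).
Hypotheses (n1_gt0 : (0 < n1)%N) (n2_gt0 : (0 < n2)%N).
Hypothesis dF : forall i u, differentiable (F i) u.
Hypothesis dG : forall j x, differentiable (G j) x.
Hypothesis F_smooth : forall i u u', l2norm (grad (F i) u - grad (F i) u') <= L_F *
  l2norm (u - u').
Hypothesis F_bnd : forall i u, l2norm (grad (F i) u) <= B_F.
Hypothesis G_smooth : forall j x x', opnorm (jac (G j) x - jac (G j) x') <= L_G *
  l2norm (x - x').
Hypothesis G_bnd : forall j x, opnorm (jac (G j) x) <= B_G.
Hypothesis f_smooth : forall i j x y,
     l2norm ((jac (G j) x)^T *m grad (F i) (Gbar G x)
             - (jac (G j) y)^T *m grad (F i) (Gbar G y)) <= L * l2norm (x - y).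
Let f := fobj F G.
Hypothesis cf : convex_function setT f.
Variables (mu : R).
Hypotheses (mu0 : 0 < mu) (muL : mu <= L).
Let m := sock_m L mu.
Let A := sock_A L_F B_G mu.
Let B := sock_B B_F L_G mu.
Let tau : R := (2 * m%:R)^-1.
Variables (h : 'cV[R]_N2 -> \bar R) (D : set 'cV[R]_N2) (hr : 'cV[R]_N2 -> R).
Hypothesis chr : sconvex D mu hr.

Definition prox c g w := argmin (fun z => (dotv g z + c * l2norm (z - w) ^+ 2)%:E + h
  z)%E.

Hypothesis proxP : forall c g w, 0 < c -> D (prox c g w) /\ forall v, D v ->
  dotv g (prox c g w) + c * dotv (prox c g w - w) (prox c g w - w) + hr (prox c g w)
  <= dotv g v + c * dotv (v - w) (v - w) + hr v.
Let H x := f x + hr x.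
Variable u : 'cV[R]_N2.
Hypotheses (Du : D u) (umin : forall w, D w -> H u <= H w).
Context {I : finType}.
Local Notation W := {ffun I -> 'I_n2}.

Let T0 : (0 < #|'I_n2|)%N. Proof. by rewrite card_ord. Qed.
Let L_gt0 : 0 < L. Proof. exact: lt_le_trans muL. Qed.

(** Redrawing the block of this step alone keeps xt, y, z and x fixed and turns the estimator into
    that of fresh draws. [katyusha_step] holds for each fresh draw, so only the squared error has to
    be averaged. *)
Lemma random_step (iA : 'I_A -> I) (iB : 'I_B -> I) (P : {set W}) (xt y z y' z' : W ->
  'cV[R]_N2) :
  injective iA -> injective iB -> (forall k l, iA k != iB l) ->
  let blk i := (i \in codom iA) || (i \in codom iB) in
  invariant_on blk (fun d => d \in P) ->
  invariant_on blk xt -> invariant_on blk y -> invariant_on blk z ->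
  (forall d, D (xt d)) -> (forall d, D (y d)) -> (forall d, D (z d)) ->
  let x d := tau *: z d + tau *: xt d + (1 - tau - tau) *: y d in
  (forall d, z' d = prox (3 * tau * L / 2) (estimator F G iA iB (x d) (xt d) d) (z d)) ->
  (forall d, y' d = prox (3 * L / 2) (estimator F G iA iB (x d) (xt d) d) (x d)) ->
  \sum_(d in P) (H (y' d) - H u
     + tau * (3 * tau * L / 2 + mu / 2) * dotv (u - z' d) (u - z' d))
  <= \sum_(d in P) (tau * (19 / 18) * (H (xt d) - H u)
     + (1 - 2 * tau + tau / 18) * (H (y d) - H u)
     + tau * (3 * tau * L / 2 + 5 / 36 * mu) * dotv (u - z d) (u - z d)).
Proof.
move=> injA injB iAB blk invP invxt invy invz Dxt Dy Dz x z'E y'E.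
apply: (ler_sum_resample T0 invP) => d dP.
have invx : invariant_on blk x.
  by move=> a b ab; rewrite /x (invxt _ _ ab) (invy _ _ ab) (invz _ _ ab).
have m0 := sock_m_gt0 mu0 muL.
have [tau0 tau1] := @tau_bnd R m m0.
have est d' : estimator F G iA iB (x d) (xt d) (mix blk d d') = estimator F G iA iB (x
  d) (xt d) d'.
  by apply: estimator_ext => k; rewrite ffunE /blk codom_f ?orbT.
pose e d' := estimator F G iA iB (x d) (xt d) d' - grad f (x d).
pose c := 2 * tau / mu + (4 * L)^-1.
pose C := tau * (H (xt d) - H u) + (1 - 2 * tau) * (H (y d) - H u)
     + tau * (3 * tau * L / 2 + mu / 8) * dotv (u - z d) (u - z d).
have L0 := L_gt0.
have tL : 0 < 3 * tau * L / 2 by rewrite !mulr_gt0// invr_gt0.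
have L32 : 0 < 3 * L / 2 by rewrite !mulr_gt0// invr_gt0.
have df : forall a, differentiable f a by move=> a; exact: differentiable_fobj.
have gL : forall a b, l2norm (grad f a - grad f b) <= L * l2norm (a - b).
  by move=> a b; exact: grad_fobj_lipschitz.
apply: (@le_trans _ _ (avg (fun d' => C + c * dotv (e d') (e d')))).
  apply: avg_le => d'.
  have [Dz' zmin] := proxP (estimator F G iA iB (x d) (xt d) d') (z d) tL.
  have [Dy' ymin] := proxP (estimator F G iA iB (x d) (xt d) d') (x d) L32.
  rewrite z'E y'E (invariant_mix _ _ invx) (invariant_mix _ _ invxt) (invariant_mix _ _
    invz) est.
  exact: (katyusha_step df gL cf chr mu0 L0 tau0 tau1 (Dy d) (Dxt d) Du Dz' Dy' zmin
    ymin).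
rewrite avgD avgZ avg_cst ?card_draws_gt0//.
have mse : avg (fun d' => dotv (e d') (e d')) <= mu ^+ 2 / 180 * dotv (x d - xt d) (x d
  - xt d).
  have A0 : (0 < A)%N by rewrite leq_maxl.
  have B0 : (0 < B)%N by rewrite leq_maxl.
  apply: le_trans (estimator_mse n1_gt0 n2_gt0 dF dG F_smooth F_bnd G_smooth G_bnd
     (x d) (xt d) A0 B0 injA injB iAB) _.
  rewrite ler_wpM2r ?dotvv_ge0//.
  have := sock_A_bnd mu0 B_G L_F; have := sock_B_bnd mu0 B_F L_G.
  rewrite -/A -/B; lra.
exact: (katyusha_error cf chr mu0 L0 tau0 tau1 (Dy d) (Dxt d) Du umin (sock_mu_le mu0
  muL) mse).
Qed.

End RandomStep.

(** * Trajectories of SoCK *)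

Section Folds.

Lemma cfold_fst X I (body : X -> I -> counted X) x s :
  (cfold body x s).1 = foldl (fun y i => (body y i).1) x s.
Proof.
rewrite /cfold; set c0 := ret x.
have -> : x = c0.1 by [].
by elim: s c0 => //= i s IH c; rewrite IH.
Qed.

Lemma cfold_snd X I (body : X -> I -> counted X) x s (c : I -> nat) :
  (forall y i, (body y i).2 <= c i)%N -> ((cfold body x s).2 <= \sum_(i <- s) c i)%N.
Proof.
move=> bc; rewrite /cfold -[X in (_ <= X)%N]add0n -[X in (X + _)%N]/(ret x).2.
elim: s (ret x) => [|i s IH] c0 /=; first by rewrite big_nil addn0.
apply: leq_trans (IH _) _; rewrite /bind /=.
by rewrite big_cons addnA leq_add2r leq_add2l.
Qed.

Lemma foldl_take_enum St m (step : St -> 'I_m -> St) st (j : 'I_m) :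
  foldl step st (take j.+1 (enum 'I_m)) = step (foldl step st (take j (enum 'I_m))) j.
Proof. by rewrite (take_nth j) ?size_enum_ord// foldl_rcons nth_ord_enum. Qed.

Lemma eq_foldl_take_enum St m (f g : St -> 'I_m -> St) st j :
  (forall st (i : 'I_m), (i < j)%N -> f st i = g st i) ->
  foldl f st (take j (enum 'I_m)) = foldl g st (take j (enum 'I_m)).
Proof.
move=> fg; have {fg} : {in take j (enum 'I_m), forall i st, f st i = g st i}.
  by move=> i; rewrite in_take ?mem_enum// index_enum_ord => ij st'; exact: fg.
elim: (take j _) st => //= i s IH st fg; rewrite fg ?mem_head// IH// => k ks.
by apply: fg; rewrite inE ks orbT.
Qed.

End Folds.

Section SockContraction.
Context {R : realType} {N1 N2 n1 n2 : nat}.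
Variables (F : 'I_n1 -> 'cV[R]_N1 -> R) (G : 'I_n2 -> 'cV[R]_N2 -> 'cV[R]_N1).
Variables (L_F B_F L_G B_G L : R).
Hypotheses (n1_gt0 : (0 < n1)%N) (n2_gt0 : (0 < n2)%N).
Hypothesis dF : forall i u, differentiable (F i) u.
Hypothesis dG : forall j x, differentiable (G j) x.
Hypothesis F_smooth : forall i u u', l2norm (grad (F i) u - grad (F i) u') <= L_F *
  l2norm (u - u').
Hypothesis F_bnd : forall i u, l2norm (grad (F i) u) <= B_F.
Hypothesis G_smooth : forall j x x', opnorm (jac (G j) x - jac (G j) x') <= L_G *
  l2norm (x - x').
Hypothesis G_bnd : forall j x, opnorm (jac (G j) x) <= B_G.
Hypothesis f_smooth : forall i j x y,
     l2norm ((jac (G j) x)^T *m grad (F i) (Gbar G x)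
             - (jac (G j) y)^T *m grad (F i) (Gbar G y)) <= L * l2norm (x - y).
Let f := fobj F G.
Hypothesis cf : convex_function setT f.
Variables (mu : R) (S : nat).
Hypotheses (mu0 : 0 < mu) (muL : mu <= L).
Let m := sock_m L mu.
Let A := sock_A L_F B_G mu.
Let B := sock_B B_F L_G mu.
Let tau : R := (2 * m%:R)^-1.
Let theta : R := 1 + (12 * m%:R)^-1.
Let Theta := \sum_(j < m) theta ^+ j.
Variables (h : 'cV[R]_N2 -> \bar R) (D : set 'cV[R]_N2) (hr : 'cV[R]_N2 -> R).
Hypothesis chr : sconvex D mu hr.
Hypothesis proxP : forall c g w, 0 < c -> D (prox h c g w) /\ forall v, D v ->
  dotv g (prox h c g w) + c * dotv (prox h c g w - w) (prox h c g w - w) + hr (prox h c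
    g w)
  <= dotv g v + c * dotv (v - w) (v - w) + hr v.
Let H x := f x + hr x.
Variable u : 'cV[R]_N2.
Hypotheses (Du : D u) (umin : forall w, D w -> H u <= H w).
Context {I : finType}.
Local Notation W := {ffun I -> 'I_n2}.
Local Notation cV := ('cV[R]_N2).
(** [iota] places the draws of one call among those of the whole run; [P] and [X] may depend on all
    the others. *)
Variable iota : 'I_S * 'I_m * ('I_A + 'I_B) -> I.
Hypothesis iota_inj : injective iota.
Variables (P : {set W}) (X : W -> cV).
Hypotheses (invP : invariant_on (fun i => i \in codom iota) (fun d => d \in P))
  (invX : invariant_on (fun i => i \in codom iota) X) (DX : forall d, D (X d)).

Let aA (d : W) s j k := d (iota (s, j, inl k)).
Let aB (d : W) s j k := d (iota (s, j, inr k)).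

Let inner (d : W) s xt st j :=
  (sock_inner F G h xt (Gbar G xt) (jacG G xt) (aA d s) (aB d s) st j).1.

Let outer (d : W) st s := (sock_outer F G h (aA d) (aB d) st s).1.

Let ostate (s : nat) (d : W) := foldl (outer d) (X d, X d, X d) (take s (enum 'I_S)).

Let xt s d := (ostate s d).1.1.
Let oy s d := (ostate s d).1.2.
Let oz s d := (ostate s d).2.

Let istate (s : 'I_S) (j : nat) (d : W) :=
  foldl (inner d s (xt s d)) (oy s d, oz s d, 0) (take j (enum 'I_m)).

Let iy s j d := (istate s j d).1.1.
Let iz s j d := (istate s j d).1.2.
Let iw s j d := (istate s j d).2.

Let gest (s : 'I_S) (j : 'I_m) x xt d :=
  estimator F G (fun k => iota (s, j, inl k)) (fun k => iota (s, j, inr k)) x xt d.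

Let inner_eq d s a y z w j :
  let x := tau *: z + tau *: a + (1 - tau - tau) *: y in
  let y' := prox h (3 * L / 2) (gest s j x a d) x in
  inner d s a (y, z, w) j =
  (y', prox h (2 * (3 * tau * L)^-1)^-1 (gest s j x a d) z, w + theta ^+ j *: y').
Proof. by []. Qed.

Let outer_eq d (s : 'I_S) :
  ostate s.+1 d = (Theta^-1 *: iw s m d, iy s m d, iz s m d).
Proof.
rewrite /ostate foldl_take_enum -/(ostate s d) /outer /iw /iy /iz /istate /xt /oy /oz.
case: (ostate s d) => [[x y] z] /=.
rewrite cfold_fst.
have -> : mean (G^~ x) = Gbar G x by rewrite /mean /Gbar card_ord.
rewrite take_oversize ?size_enum_ord// /inner /jacG.
by case: foldl => [[y' z'] w'].
Qed.

Let istepE (s : 'I_S) (j : 'I_m) d :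
  let x := tau *: iz s j d + tau *: xt s d + (1 - tau - tau) *: iy s j d in
  [/\ iy s j.+1 d = prox h (3 * L / 2) (gest s j x (xt s d) d) x,
      iz s j.+1 d = prox h (3 * tau * L / 2) (gest s j x (xt s d) d) (iz s j d)
    & iw s j.+1 d = iw s j d + theta ^+ j *: iy s j.+1 d].
Proof.
have m0 := sock_m_gt0 mu0 muL.
have L0 : L != 0 by rewrite gt_eqF// (lt_le_trans mu0).
have -> : 3 * tau * L / 2 = (2 * (3 * tau * L)^-1)^-1.
  by rewrite /tau; field; rewrite L0 pnatr_eq0 -lt0n m0.
rewrite /iy /iz /iw /istate foldl_take_enum -/(istate s j d).
by case: (istate s j d) => [[y z] w]; rewrite inner_eq.
Qed.

Let L_gt0 : 0 < L. Proof. exact: lt_le_trans muL. Qed.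
Let m_gt0 : (0 < m)%N. Proof. exact: sock_m_gt0. Qed.
Let tau_gt0 : 0 < tau. Proof. by have [] := @tau_bnd R m m_gt0. Qed.

Let inner_D (s : 'I_S) d j : D (oy s d) -> D (oz s d) -> D (iy s j d) /\ D (iz s j d).
Proof.
move=> Dy Dz; rewrite /iy /iz /istate.
have L32 : 0 < 3 * L / 2 by rewrite !mulr_gt0// invr_gt0.
have tL : 0 < (2 * (3 * tau * L)^-1)^-1 by rewrite invr_gt0 mulr_gt0// invr_gt0 !mulr_gt0.
set st := (oy s d, oz s d, 0).
have: D st.1.1 /\ D st.1.2 by [].
elim: (take j _) st => //= i l IH [[y z] w] _; apply: IH; rewrite inner_eq.
by split; [have [] := proxP (gest s i (tau *: z + tau *: xt s d + (1 - tau - tau) *: y)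
  (xt s d) d)
  (tau *: z + tau *: xt s d + (1 - tau - tau) *: y) L32|
  have [] := proxP (gest s i (tau *: z + tau *: xt s d + (1 - tau - tau) *: y) (xt s d)
    d) z tL].
Qed.

Let theta_gt0 : 0 < theta.
Proof. by rewrite /theta ltr_pwDl. Qed.

Let iw_sum (s : 'I_S) j d : (j <= m)%N -> iw s j d = \sum_(i < j) theta ^+ i *: iy s
  i.+1 d.
Proof.
elim: j => [_|j IH jm]; first by rewrite big_ord0 /iw /istate take0.
have [_ _ ->] := istepE s (Ordinal jm) d.
by rewrite big_ord_recr /= IH// ltnW.
Qed.

Let sconvexH : sconvex D mu H.
Proof. exact: sconvex_H cf chr. Qed.

Let outer_jensen (s : 'I_S) d : D (oy s d) -> D (oz s d) ->
  D (xt s.+1 d) /\ Theta * (H (xt s.+1 d) - H u) <= \sum_(i < m) theta ^+ i * (H (iy s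
    i.+1 d) - H u).
Proof.
move=> Dy Dz; rewrite /xt outer_eq /= iw_sum// /Theta.
have [k mk] : exists k, m = k.+1 by exists m.-1; rewrite (prednK m_gt0).
have := @sconvex_jensen R _ D mu H k (fun i => theta ^+ i) (fun i => iy s i.+1 d)
  sconvexH (ltW mu0).
rewrite -mk; case=> [i|i _|Dp hp]; first exact: exprn_gt0.
  by have [] := inner_D i.+1 Dy Dz.
split; first exact: Dp.
rewrite mulrBr; under [leRHS]eq_bigr do rewrite mulrBr.
by rewrite sumrB -mulr_suml lerD2r.
Qed.

Let outer_D s d : (s <= S)%N -> [/\ D (xt s d), D (oy s d) & D (oz s d)].
Proof.
elim: s => [_|s IH sS]; first by rewrite /xt /oy /oz /ostate take0; split; exact: DX.
have [Dx Dy Dz] := IH (ltnW sS).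
have [Dx' _] := @outer_jensen (Ordinal sS) d Dy Dz.
have [Dy' Dz'] := @inner_D (Ordinal sS) d m Dy Dz.
by split=> //; rewrite /oy /oz (outer_eq d (Ordinal sS)).
Qed.

Let blk s j i := (i \in codom (fun k => iota (s, j, inl k))) || (i \in codom (fun k =>
  iota (s, j, inr k))).

Let blk_sub s j i : blk s j i -> i \in codom iota.
Proof. by case/orP => /codomP[k ->]; exact: codom_f. Qed.

Let blk_off (d d' : W) s j s1 j1 k : (forall i, ~~ blk s j i -> d i = d' i) ->
  (s1, j1) != (s, j) -> d (iota (s1, j1, k)) = d' (iota (s1, j1, k)).
Proof.
move=> dd' sj; apply: dd'; apply/negP => /orP[] /codomP[k' /iota_inj [es ej _]];
  by rewrite es ej eqxx in sj.
Qed.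

Let blk_invariant V (Y : W -> V) s j :
  invariant_on (fun i => i \in codom iota) Y -> invariant_on (blk s j) Y.
Proof. by move=> inv d d' dd'; apply: inv => i /negP ni; apply: dd'; apply/negP =>
  /blk_sub. Qed.

(** Epochs before s read blocks with a smaller epoch index, and the starting point reads no draw of
    this call. *)
Let ostate_inv (s : 'I_S) (j : 'I_m) s1 : (s1 <= s)%N -> invariant_on (blk s j) (ostate
  s1).
Proof.
move=> s1s d d' dd'; rewrite /ostate (blk_invariant invX dd').
apply: eq_foldl_take_enum => -[[x y] z] s2 s21; rewrite /outer.
have ne j1 : (s2, j1) != (s, j).
  apply/eqP => -[e _]; rewrite e in s21; have := leq_trans s21 s1s; by rewrite ltnn.
have eA : aA d s2 = aA d' s2 by apply/funext => j1; apply/funext => k; exact: blk_off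
  dd' (ne j1).
have eB : aB d s2 = aB d' s2 by apply/funext => j1; apply/funext => k; exact: blk_off
  dd' (ne j1).
by rewrite /sock_outer eA eB.
Qed.

Let istate_inv (s : 'I_S) (j : 'I_m) j1 : (j1 <= j)%N -> invariant_on (blk s j) (istate
  s j1).
Proof.
move=> j1j d d' dd'.
have e := ostate_inv (leqnn s) dd'.
rewrite /istate /xt /oy /oz e.
apply: eq_foldl_take_enum => -[[y z] w] j2 j21; rewrite !inner_eq.
have ne : (s, j2) != (s, j).
  apply/eqP => -[e']; rewrite e' in j21; have := leq_trans j21 j1j; by rewrite ltnn.
have ge x a : gest s j2 x a d = gest s j2 x a d'.
  by apply: estimator_ext => k; exact: blk_off dd' ne.
by rewrite ge.
Qed.

Let q s := \sum_(d in P) (H (xt s d) - H u).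
Let p (s : 'I_S) j := \sum_(d in P) (H (iy s j d) - H u).
Let zt (s : 'I_S) j := \sum_(d in P) dotv (u - iz s j d) (u - iz s j d).
Let K := tau * (3 * tau * L / 2 + 5 / 36 * mu).
Let rho := 1 - 2 * tau + tau / 18.

Let sum_step (s : 'I_S) j : (j < m)%N ->
  p s j.+1 + tau * (3 * tau * L / 2 + mu / 2) * zt s j.+1
    <= tau * (19 / 18) * q s + rho * p s j + K * zt s j.
Proof.
move=> jm; pose j' := Ordinal jm.
have Ds d := outer_D d (ltnW (ltn_ord s)).
have Di d : D (iy s j d) /\ D (iz s j d) by have [_ Dy Dz] := Ds d; exact: inner_D.
have injA : injective (fun k : 'I_A => iota (s, j', inl k)) by move=> k l /iota_inj[].
have injB : injective (fun k : 'I_B => iota (s, j', inr k)) by move=> k l /iota_inj[].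
have iAB k l : iota (s, j', inl k) != iota (s, j', inr l) by apply/eqP => /iota_inj[].
have invx : invariant_on (blk s j') (xt s).
  by move=> d d' dd'; rewrite /xt (ostate_inv (leqnn s) dd').
have invy : invariant_on (blk s j') (iy s j).
  by move=> d d' dd'; rewrite /iy (istate_inv (j := j') (leqnn j) dd').
have invz : invariant_on (blk s j') (iz s j).
  by move=> d d' dd'; rewrite /iz (istate_inv (j := j') (leqnn j) dd').
have := random_step n1_gt0 n2_gt0 dF dG F_smooth F_bnd G_smooth G_bnd f_smooth cf mu0 muL
  chr proxP Du umin injA injB iAB (blk_invariant invP) invx invy invz
  (fun d => let: And3 a _ _ := Ds d in a) (fun d => proj1 (Di d)) (fun d => proj2 (Di d))
  (fun d => let: And3 _ b _ := istepE s j' d in b)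
  (fun d => let: And3 a _ _ := istepE s j' d in a).
rewrite /p /zt /q !mulr_sumr -!big_split /=; exact.
Qed.

Let H_ge s d : (s <= S)%N -> 0 <= H (xt s d) - H u.
Proof. by move=> /(outer_D d)[Dx _ _]; rewrite subr_ge0; exact: umin. Qed.

Let Phi s := tau * (19 / 18) * Theta * q s
  + rho * \sum_(d in P) (H (oy s d) - H u)
  + K * \sum_(d in P) dotv (u - oz s d) (u - oz s d).

Let epoch s : (s < S)%N -> 13 / 12 * Phi s.+1 <= Phi s.
Proof.
move=> sS; pose s' := Ordinal sS.
have Ds d := outer_D d (ltnW sS).
have p0 j : 0 <= p s' j.
  apply: sumr_ge0 => d _; rewrite subr_ge0; apply: umin.
  by have [_ Dy Dz] := Ds d; have [] := @inner_D s' d j Dy Dz.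
have z0 j : 0 <= zt s' j by apply: sumr_ge0 => d _; exact: dotvv_ge0.
have := epoch_telescope m_gt0 mu0 L_gt0 (sock_tauL mu0 muL) p0 z0 (@sum_step s').
have -> : p s' 0 = \sum_(d in P) (H (oy s d) - H u) by apply: eq_bigr => d _; rewrite
  /iy /istate take0.
have -> : zt s' 0 = \sum_(d in P) dotv (u - oz s d) (u - oz s d) by apply: eq_bigr => d
  _; rewrite /iz /istate take0.
apply: le_trans; rewrite ler_pM2l ?divr_gt0//.
have -> : p s' m = \sum_(d in P) (H (oy s.+1 d) - H u).
  by apply: eq_bigr => d _; rewrite /oy (outer_eq d s').
have -> : zt s' m = \sum_(d in P) dotv (u - oz s.+1 d) (u - oz s.+1 d).
  by apply: eq_bigr => d _; rewrite /oz (outer_eq d s').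
rewrite !lerD2r -mulrA ler_wpM2l//.
  by rewrite mulr_ge0// ltW.
rewrite /q mulr_sumr (eq_bigr (fun i : 'I_m => \sum_(d in P) theta ^+ i * (H (iy s'
  i.+1 d) - H u))); last first.
  by move=> i _; rewrite mulr_sumr.
rewrite exchange_big /=; apply: ler_sum => d _.
by have [_ Dy Dz] := Ds d; have [] := @outer_jensen s' d Dy Dz.
Qed.

Definition sock_run (d : W) (x : cV) : counted cV :=
  sock F G h x (fun s j k => d (iota (s, j, inl k))) (fun s j k => d (iota (s, j, inr
    k))).

Let sock_runE d : (sock_run d (X d)).1 = xt S d.
Proof. by rewrite /sock_run /sock /= cfold_fst /xt /ostate take_oversize//
  size_enum_ord. Qed.

Lemma sock_run_D d : D (sock_run d (X d)).1.
Proof. by rewrite sock_runE; have [] := outer_D d (leqnn S). Qed.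

(** All three points start at X, so Phi 0 <= (tau Theta 19/18 + rho + 2 K/mu) q 0 with rho <= 1 and
    2 K/mu <= 4; as tau Theta >= 1/2, this is at most 11 times the weight of q S in Phi S. *)
Lemma sock_contraction :
  (13 / 12) ^+ S * \sum_(d in P) (H (sock_run d (X d)).1 - H u)
    <= 11 * \sum_(d in P) (H (X d) - H u).
Proof.
have -> : \sum_(d in P) (H (sock_run d (X d)).1 - H u) = q S.
  by apply: eq_bigr => d _; rewrite sock_runE.
have -> : \sum_(d in P) (H (X d) - H u) = q 0.
  by apply: eq_bigr => d _; rewrite /xt /ostate take0.
have iter s : (s <= S)%N -> (13 / 12) ^+ s * Phi s <= Phi 0.
  elim: s => [_|s IH sS]; first by rewrite expr0 mul1r.
  apply: le_trans (IH (ltnW sS)); rewrite exprSr -mulrA ler_wpM2l ?exprn_ge0 ?divr_ge0//.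
  exact: epoch.
have {iter} := iter S (leqnn S).
have [t0 t1] := @tau_bnd R m m_gt0.
have qS : 0 <= q S by apply: sumr_ge0 => d _; exact: H_ge.
have q0 : 0 <= q 0 by apply: sumr_ge0 => d _; exact: H_ge.
have th1 : 1 <= theta by rewrite /theta lerDl invr_ge0.
have tTh : 2^-1 <= tau * Theta.
  have -> : 2^-1 = tau * m%:R :> R.
    by rewrite /tau; field; rewrite pnatr_eq0 -lt0n m_gt0.
  rewrite ler_wpM2l ?(ltW t0)// /Theta -[leLHS]mulr1 mulr_natl -[X in _ *+ X](card_ord
    m) -sumr_const.
  by apply: ler_sum => i _; rewrite exprn_ege1.
have rho0 : 0 <= rho by rewrite /rho -/tau in t0 t1 *; lra.
have rho1 : rho <= 1 by rewrite /rho -/tau in t0 t1 *; lra.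
have tL := sock_tauL mu0 muL.
have mu_gt0 := mu0.
have L_gt0' := L_gt0.
have K0 : 0 <= K by rewrite /K mulr_ge0 ?addr_ge0// ?mulr_ge0// ltW.
have K4 : K * (2 / mu) <= 4.
  rewrite mulrA ler_pdivrMr// /K.
  have : tau * mu <= mu by rewrite ler_piMl ?(ltW mu0)//; rewrite -/tau in t1 t0; lra.
  have : tau * (tau * L) <= mu by rewrite mulrA -expr2.
  lra.
have Z0 : \sum_(d in P) dotv (u - oz 0 d) (u - oz 0 d) <= 2 / mu * q 0.
  rewrite /q mulr_sumr; apply: ler_sum => d _.
  rewrite /oz /xt /ostate take0 /=.
  exact: (dist_min cf chr mu0 Du umin (DX d)).
have P0 : \sum_(d in P) (H (oy 0 d) - H u) = q 0.
  by apply: eq_bigr => d _; rewrite /oy /xt /ostate take0.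
have PS : tau * (19 / 18) * Theta * q S <= Phi S.
  rewrite /Phi -addrA lerDl addr_ge0// mulr_ge0//; apply: sumr_ge0 => d _.
    by rewrite subr_ge0; apply: umin; have [] := outer_D d (leqnn S).
  exact: dotvv_ge0.
have c0 : 0 <= (13 / 12 : R) ^+ S by rewrite exprn_ge0// divr_ge0.
have := ler_wpM2l c0 PS => h1 h2; have {h1 h2} := le_trans h1 h2.
have h3 : Phi 0 <= (tau * Theta * (19 / 18) + 5) * q 0.
  rewrite /Phi P0.
  have := ler_wpM2l K0 Z0; rewrite mulrA => h3.
  have := ler_wpM2r q0 K4 => h4.
  have := ler_wpM2r q0 rho1 => h5.
  lra.
move=> h1; have := le_trans h1 h3 => h4.
have tTh0 : 0 < tau * Theta by rewrite (lt_le_trans _ tTh)// invr_gt0.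
have h6 : (tau * Theta * (19 / 18) + 5) * q 0 <= tau * Theta * (19 / 18) * 11 * q 0.
  rewrite ler_wpM2r//; lra.
have := le_trans h4 h6.
have -> : (13 / 12) ^+ S * (tau * (19 / 18) * Theta * q S) =
  (tau * Theta * (19 / 18)) * ((13 / 12) ^+ S * q S) by ring.
rewrite -[X in _ <= X]mulrA ler_pM2l// mulr_gt0// divr_gt0//.
Qed.

End SockContraction.

(** * Regularized objectives *)

Section Regularization.
Context {R : realType} {N : nat}.
Variables (f : 'cV[R]_N -> R) (h : 'cV[R]_N -> \bar R) (K : R) (xs x0 : 'cV[R]_N).
Hypothesis df : forall x, differentiable f x.
Hypothesis f_lip : forall x y, f x - f y <= K * l2norm (x - y).
Hypothesis hP : proper_closed_convex h.
Hypothesis xs_min : forall x, ((f xs)%:E + h xs <= (f x)%:E + h x)%E.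

Definition edom : set 'cV[R]_N := [set x | h x != +oo%E].
Let hr x := fine (h x).

Lemma edomE x : edom x -> h x = (hr x)%:E.
Proof.
have [hN _ _ _] := hP => Dx.
by rewrite /hr fineK// fin_numE hN Dx.
Qed.

Lemma edom_min : edom xs.
Proof.
have [_ [x Dx] _ _] := hP; apply/eqP => hoo.
by have := xs_min x; rewrite hoo (edomE Dx) addey// -EFinD leye_eq.
Qed.

(** As xs minimizes f + h and f is Lipschitz, h decreases at most linearly away from xs; this makes
    every proximal objective coercive. *)
Let hr_lb z : ((hr xs - K * l2norm (z - xs))%:E <= h z)%E.
Proof.
have [hN _ _ _] := hP.
have := xs_min z; rewrite (edomE edom_min).
case E : (h z) => [r| |]; last by have := hN z; rewrite E.
  rewrite -!EFinD !lee_fin; have := f_lip z xs; lra.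
by move=> _; rewrite leey.
Qed.

Lemma sconvex_fine : sconvex edom 0 hr.
Proof.
have [hN _ _ hc] := hP => x y t Dx Dy t01.
have := hc x y t t01; rewrite (edomE Dx) (edomE Dy) -!EFinM -EFinD => hle.
have Dt : edom (t *: x + (1 - t) *: y).
  by apply/eqP => E; rewrite E leye_eq in hle.
split=> //; move: hle; rewrite (edomE Dt) lee_fin; lra.
Qed.

Definition hreg a z := (h z + (a * l2norm (z - x0) ^+ 2)%:E)%E.
Definition hregr a z := hr z + a * dotv (z - x0) (z - x0).

Lemma hregE a z : edom z -> hreg a z = (hregr a z)%:E.
Proof. by move=> Dz; rewrite /hreg (edomE Dz) -EFinD sqr_l2norm. Qed.

Lemma sconvex_hregr a : sconvex edom (2 * a) (hregr a).
Proof.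
have := sconvexD sconvex_fine (sconvex_quad 0 x0 a); rewrite add0r.
have -> : (fun x => dotv 0 x + a * dotv (x - x0) (x - x0) + hr x) = hregr a.
  by apply/funext => z; rewrite dotvC dotv0r add0r addrC.
by [].
Qed.

(** Recenters a quadratic at xs, where the lower bound on h is anchored, at the price of a linear
    term. *)
Let l2norm_ge (z w : 'cV[R]_N) : l2norm (z - xs) ^+ 2 - 2 * l2norm (xs - w) * l2norm (z
  - xs)
  <= dotv (z - w) (z - w).
Proof.
have -> : z - w = (z - xs) + (xs - w) by rewrite addrA subrK.
have := cauchy_schwarz (- (z - xs)) (xs - w); rewrite l2normN dotvNl.
have := dotvv_ge0 (xs - w).
move: (z - xs) (xs - w) => p q; have -> : dotv (p + q) (p + q) = dotv p p + 2 * dotv p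
  q + dotv q q.
  by rewrite !dotvL (dotvC q p); ring.
rewrite -!sqr_l2norm; lra.
Qed.

Let attains (q : 'cV[R]_N -> R) c b k : continuous q -> 0 < c ->
  (forall z, c * l2norm (z - xs) ^+ 2 - b * l2norm (z - xs) - k <= q z) ->
  exists p, forall w, ((q p)%:E + h p <= (q w)%:E + h w)%E.
Proof.
move=> cq c0 lb; have [hN _ hlsc _] := hP.
apply: (@coercive_min _ _ (fun z => (q z)%:E + h z)%E xs c (b + K) (k - hr xs) (q xs +
  hr xs)) => //.
- exact: lsc_addl.
- by rewrite (edomE edom_min).
- move=> z; apply: (@le_trans _ _ ((q z)%:E + (hr xs - K * l2norm (z - xs))%:E)%E).
    by rewrite -EFinD lee_fin; have := lb z; lra.
  by rewrite leeD2l// hr_lb.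
Qed.

Lemma quad_continuous (g : 'cV[R]_N) c w a : continuous (fun z : 'cV[R]_N =>
  dotv g z + c * dotv (z - w) (z - w) + a * dotv (z - x0) (z - x0)).
Proof.
move=> z.
have -> : (fun z : 'cV[R]_N => dotv g z + c * dotv (z - w) (z - w) + a * dotv (z - x0)
  (z - x0))
  = (dotv g + c *: (fun z : 'cV[R]_N => dotv (z - w) (z - w))) + a *: (fun z : 'cV[R]_N
    => dotv (z - x0) (z - x0)) by [].
have c1 : {for z, continuous (dotv g)}.
  apply: (@dotv_continuous R N (cst g) id); [exact: cst_continuous|by move=> y; exact:
    cvg_id].
have c2 w' : {for z, continuous (fun z : 'cV[R]_N => dotv (z - w') (z - w'))}.
  exact: sqdist_continuous.
have cz k w' : {for z, continuous (k *: (fun z : 'cV[R]_N => dotv (z - w') (z - w')))}.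
  by apply: (@continuousM R _ (cst k)) => //; exact: cst_continuous.
by apply: (@continuousD R R^o) => //; apply: (@continuousD R R^o).
Qed.

Lemma prox_hreg a c g w : 0 <= a -> 0 < c ->
  edom (prox (hreg a) c g w) /\ forall v, edom v ->
  dotv g (prox (hreg a) c g w) + c * dotv (prox (hreg a) c g w - w) (prox (hreg a) c g
    w - w)
    + hregr a (prox (hreg a) c g w)
  <= dotv g v + c * dotv (v - w) (v - w) + hregr a v.
Proof.
move=> a0 c0.
pose q (z : 'cV[R]_N) := dotv g z + c * dotv (z - w) (z - w) + a * dotv (z - x0) (z - x0).
have qE z : ((dotv g z + c * l2norm (z - w) ^+ 2)%:E + hreg a z = (q z)%:E + h z)%E.
  have [hN _ _ _] := hP.
  by rewrite /hreg [(h z + _)%E]addeC addeA -EFinD !sqr_l2norm.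
have [p pmin] : exists p, forall w, ((q p)%:E + h p <= (q w)%:E + h w)%E.
  apply: (@attains q c (2 * c * l2norm (xs - w) + l2norm g) (- dotv g xs)) => //.
    exact: quad_continuous.
  move=> z; rewrite /q.
  have cs : dotv g xs - dotv g z <= l2norm g * l2norm (z - xs).
    by have := cauchy_schwarz (- g) (z - xs); rewrite l2normN dotvNl dotvDr dotvNr; lra.
  have := ler_wpM2l (ltW c0) (l2norm_ge z w).
  have := mulr_ge0 a0 (dotvv_ge0 (z - x0)); lra.
have := @argmin_le R N (fun z => (dotv g z + c * l2norm (z - w) ^+ 2)%:E + hreg a z)%E.
rewrite -/(prox (hreg a) c g w); set p' := prox _ _ _ _ => h1.
have {h1} pm v : ((q p')%:E + h p' <= (q v)%:E + h v)%E.
  by rewrite -!qE; apply: h1; exists p => v'; rewrite !qE.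
have Dp : edom p'.
  apply/eqP => E; have := pm xs; rewrite E (edomE edom_min) addey// -EFinD leye_eq//.
split=> // v Dv; have := pm v; rewrite (edomE Dp) (edomE Dv) -!EFinD lee_fin /q /hregr;
  lra.
Qed.

(** Here f + h is bounded below by its value at xs, so the regularizer alone provides coercivity. *)
Lemma hreg_min a : 0 < a ->
  exists2 u, edom u & forall v, ((f u)%:E + hreg a u <= (f v)%:E + hreg a v)%E.
Proof.
move=> a0; have [hN _ hlsc _] := hP.
pose q (z : 'cV[R]_N) := f z + a * dotv (z - x0) (z - x0).
have qE z : ((f z)%:E + hreg a z = (q z)%:E + h z)%E.
  by rewrite /hreg [(h z + _)%E]addeC addeA -EFinD !sqr_l2norm.
have cq : continuous q.
  move=> z; rewrite (_ : q = f + a *: (fun z : 'cV[R]_N => dotv (z - x0) (z - x0)))//.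
  apply: (@continuousD R R^o); first exact: differentiable_continuous.
  by apply: (@continuousM R _ (cst a)); [exact: cst_continuous|exact: sqdist_continuous].
have [p pm] : exists p, forall w, ((q p)%:E + h p <= (q w)%:E + h w)%E.
  have lscq := lsc_addl hN hlsc cq.
  apply: (coercive_min (z0 := xs) (c := a) (b := 2 * a * l2norm (xs - x0)) (k := - (f
    xs + hr xs)) (s := q xs + hr xs) lscq a0).
    by rewrite (edomE edom_min).
  move=> z; apply: (@le_trans _ _ ((a * dotv (z - x0) (z - x0))%:E + ((f xs)%:E + h
    xs))%E).
    rewrite (edomE edom_min) -!EFinD lee_fin.
    by have := ler_wpM2l (ltW a0) (l2norm_ge z x0); lra.
  by rewrite /q EFinD [((f z)%:E + _)%E]addeC -addeA leeD2l// xs_min.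
exists p => [|v]; last by rewrite !qE.
apply/eqP => E; have := pm xs; rewrite E (edomE edom_min) addey// -EFinD leye_eq//.
Qed.

End Regularization.

(** * The outer loop NoCK *)

Section NockMu.
Context {R : realType}.

Lemma nock_muS (mu0 : R) t : nock_mu mu0 t.+1 = nock_mu mu0 t / 2.
Proof. by []. Qed.

Lemma nock_mu_gt0 (mu0 : R) t : 0 < mu0 -> 0 < nock_mu mu0 t.
Proof. by move=> m0; elim: t => // t IH; rewrite nock_muS divr_gt0. Qed.

Lemma nock_mu_le (mu0 : R) t : 0 < mu0 -> nock_mu mu0 t <= mu0.
Proof.
move=> m0; elim: t => // t IH; rewrite nock_muS.
by have := nock_mu_gt0 t m0; lra.
Qed.

Lemma nock_muE (mu0 : R) t : nock_mu mu0 t = mu0 / 2 ^+ t.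
Proof.
elim: t => [|t IH]; first by rewrite expr0 divr1.
by rewrite nock_muS IH exprSr invfM mulrA.
Qed.

(** Bernoulli gives (13/12)^12 >= 2, and 96 = 12 * 8 with 2^8 = 256 >= 132. The product 11 * 12
    turns the factor 11 of [sock_contraction] into 1/12. *)
Lemma contraction_factor S : (96 <= S)%N -> 11 * 12 <= (13 / 12 : R) ^+ S.
Proof.
move=> S96; have h1 : 2 <= (13 / 12 : R) ^+ 12.
  have i12 : 0 <= 12^-1 :> R by rewrite invr_ge0.
  by have := bernoulli 12 i12; rewrite mulfV ?pnatr_eq0// (_ : 1 + 12^-1 = 13 / 12 :>
    R)//; field.
apply: (@le_trans _ _ ((13 / 12 : R) ^+ 96)); last first.
  by rewrite ler_weXn2l// ler_pdivlMr// mul1r ler_nat.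
rewrite (_ : 96 = 12 * 8)%N// exprM.
apply: (@le_trans _ _ (2 ^+ 8)); first by rewrite -natrX -natrM ler_nat.
by rewrite lerXn2r// nnegrE ?exprn_ge0// divr_ge0.
Qed.

End NockMu.

Section Nock.
Context {R : realType} {N1 N2 n1 n2 : nat}.
Variables (F : 'I_n1 -> 'cV[R]_N1 -> R) (G : 'I_n2 -> 'cV[R]_N2 -> 'cV[R]_N1).
Variables (h : 'cV[R]_N2 -> \bar R) (L_F B_F L_G B_G L : R).
Variables (x0 xs : 'cV[R]_N2) (S T : nat) (mu0 D_H D_x : R).
Hypotheses (n1_gt0 : (0 < n1)%N) (n2_gt0 : (0 < n2)%N).
Hypothesis dF : forall i u, differentiable (F i) u.
Hypothesis dG : forall j x, differentiable (G j) x.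
Hypothesis hP : proper_closed_convex h.
Let f := fobj F G.
Hypothesis cf : convex_function setT f.
Hypothesis F_smooth : forall i u u', l2norm (grad (F i) u - grad (F i) u') <= L_F *
  l2norm (u - u').
Hypothesis F_bnd : forall i u, l2norm (grad (F i) u) <= B_F.
Hypothesis G_smooth : forall j x x', opnorm (jac (G j) x - jac (G j) x') <= L_G *
  l2norm (x - x').
Hypothesis G_bnd : forall j x, opnorm (jac (G j) x) <= B_G.
Hypothesis f_smooth : forall i j x y,
     l2norm ((jac (G j) x)^T *m grad (F i) (Gbar G x)
             - (jac (G j) y)^T *m grad (F i) (Gbar G y)) <= L * l2norm (x - y).
Hypothesis xs_min : forall x, (Hobj F G h xs <= Hobj F G h x)%E.
Hypothesis H_gap : (Hobj F G h x0 - Hobj F G h xs <= D_H%:E)%E.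
Hypothesis x0_dist : l2norm (x0 - xs) ^+ 2 <= D_x.
Hypotheses (mu0_gt0 : 0 < mu0) (mu0_le : mu0 <= L) (mu0E : mu0 * D_x = D_H).
Hypothesis S96 : (96 <= S)%N.

Local Notation mu := (nock_mu mu0).
Let X := nock_x F G L_F B_F L_G B_G L S h x0 mu0 T.
Let W := @draws R n2 L_F B_F L_G B_G L S mu0 T.
Let idx := @draw_idx R L_F B_F L_G B_G L S mu0 T.
Let D := edom h.
Let hr t := hregr h x0 (mu t / 2).
Let Hr t x := f x + hr t x.

Let iota (t : 'I_T) :
    'I_S * 'I_(sock_m L (mu t)) * ('I_(sock_A L_F B_G (mu t)) + 'I_(sock_B B_F L_G (mu
      t))) ->
    {t : 'I_T & idx t} :=
  fun k => @Tagged 'I_T t idx k.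
Local Arguments iota : clear implicits.

Let iota_inj t : injective (iota t).
Proof. by move=> k l /eqP; rewrite eq_Tagged => /eqP. Qed.

Let XE t d : X t d = foldl (fun x (i : 'I_T) =>
  (sock_run F G (nock_h h x0 mu0 i) (iota i) d x).1) x0 (take t (enum 'I_T)).
Proof. by rewrite /X /nock_x /nock cfold_fst. Qed.

Let XS (t : 'I_T) d : X t.+1 d =
  (sock_run F G (nock_h h x0 mu0 t) (iota t) d (X t d)).1.
Proof. by rewrite !XE foldl_take_enum. Qed.

Let X_inv (t : 'I_T) : invariant_on (fun i => i \in codom (iota t)) (X t).
Proof.
move=> d d' dd'; rewrite !XE.
apply: eq_foldl_take_enum => x i it.
suff e k : d (iota i k) = d' (iota i k).
  have eA : (fun s j k => d (iota i (s, j, inl k))) = (fun s j k => d' (iota i (s, j,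
    inl k))).
    by do 3! apply/funext => ?; exact: e.
  have eB : (fun s j k => d (iota i (s, j, inr k))) = (fun s j k => d' (iota i (s, j,
    inr k))).
    by do 3! apply/funext => ?; exact: e.
  by rewrite /sock_run eA eB.
(* A draw of an earlier call carries a tag i < t and so lies outside the range of [iota t]. *)
apply: dd'; apply/codomP => -[l /(congr1 tag) /= e].
by rewrite e ltnn in it.
Qed.

Let f_lip x y : f x - f y <= B_G * B_F * l2norm (x - y).
Proof. exact: fobj_lipschitz. Qed.

Let df x : differentiable f x.
Proof. exact: differentiable_fobj. Qed.

Let mu_gt0 t : 0 < mu t. Proof. exact: nock_mu_gt0. Qed.

Let mu_le t : mu t <= L. Proof. exact: le_trans (nock_mu_le _ _) mu0_le. Qed.

Let half_mu_gt0 t : 0 < mu t / 2. Proof. by rewrite divr_gt0. Qed.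

Let chr t : sconvex D (mu t) (hr t).
Proof.
have := @sconvex_hregr R N2 h x0 hP (mu t / 2).
by rewrite mulrC divfK// pnatr_eq0.
Qed.

Let proxP t c g w : 0 < c -> D (prox (nock_h h x0 mu0 t) c g w) /\ forall v, D v ->
  dotv g (prox (nock_h h x0 mu0 t) c g w)
  + c * dotv (prox (nock_h h x0 mu0 t) c g w - w) (prox (nock_h h x0 mu0 t) c g w - w)
  + hr t (prox (nock_h h x0 mu0 t) c g w)
  <= dotv g v + c * dotv (v - w) (v - w) + hr t v.
Proof. by move=> c0; exact: (prox_hreg x0 f_lip hP xs_min g w (ltW (half_mu_gt0 t))
  c0). Qed.

Let nock_HE t x : D x -> nock_H F G h x0 mu0 t x = (Hr t x)%:E.
Proof.
move=> Dx; have := hregE x0 hP (mu t / 2) Dx.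
by rewrite /nock_H /Hobj -addeA -/(hreg h x0 (mu t / 2) x) => ->; rewrite -EFinD.
Qed.

Let minimizer t : exists u, [/\ D u, forall w, D w -> Hr t u <= Hr t w
  & nock_Hmin F G h x0 mu0 t = (Hr t u)%:E].
Proof.
have [u Du umin] := hreg_min x0 df hP xs_min (half_mu_gt0 t).
have uminH w : (nock_H F G h x0 mu0 t u <= nock_H F G h x0 mu0 t w)%E.
  by rewrite /nock_H /Hobj -!addeA; exact: umin.
exists u; split=> // [w Dw|].
  by have := uminH w; rewrite !nock_HE// lee_fin.
rewrite -nock_HE//; apply/eqP; rewrite eq_le; apply/andP; split.
  by apply: ereal_inf_lbound; exists u.
by apply: le_ereal_inf_tmp => _ [w _ <-]; exact: uminH.
Qed.

Let Dxs : D xs. Proof. exact: edom_min hP xs_min. Qed.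

Let Hs := f xs + fine (h xs).

Let HobjE x : D x -> Hobj F G h x = (f x + fine (h x))%:E.
Proof. by move=> Dx; rewrite /Hobj (edomE hP Dx) -EFinD. Qed.

Let Dx0 : D x0.
Proof.
apply/eqP => E; move: H_gap; rewrite (HobjE Dxs) /Hobj E addey//.
Qed.

Let DX (t : nat) d : (t <= T)%N -> D (X t d).
Proof.
elim: t d => [d _|t IH d tT]; first by rewrite /X /nock_x /nock take0.
rewrite (XS (Ordinal tT)).
exact: (sock_run_D cf (mu_gt0 t) (mu_le t) (chr t) (@proxP t) xs (@iota (Ordinal tT))
  (fun d => IH d (ltnW tT))).
Qed.

Let contraction (t : 'I_T) (P : {set W}) u :
  D u -> (forall w, D w -> Hr t u <= Hr t w) ->
  invariant_on (fun i => i \in codom (iota t)) (fun d => d \in P) ->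
  \sum_(d in P) (Hr t (X t.+1 d) - Hr t u) <= 12^-1 * \sum_(d in P) (Hr t (X t d) - Hr
    t u).
Proof.
move=> Du umin invP.
have := sock_contraction n1_gt0 n2_gt0 dF dG F_smooth F_bnd G_smooth G_bnd f_smooth cf
  (mu_gt0 t) (mu_le t) (chr t) (@proxP t) Du umin (@iota_inj t) invP (@X_inv t)
  (fun d => DX d (ltnW (ltn_ord t))).
have -> : \sum_(d in P) (f (sock_run F G (nock_h h x0 mu0 t) (@iota t) d (X t d)).1 +
     hr t (sock_run F G (nock_h h x0 mu0 t) (@iota t) d (X t d)).1 - (f u + hr t u))
  = \sum_(d in P) (Hr t (X t.+1 d) - Hr t u).
  by apply: eq_bigr => d _; rewrite XS.
rewrite -/(Hr t); set a := \sum_(d in P) (Hr t (X t.+1 d) - _); set b := \sum_(d in P)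
  _ => hab.
have a0 : 0 <= a.
  by apply: sumr_ge0 => d _; rewrite subr_ge0; apply: umin; exact: DX.
have := ler_wpM2r a0 (@contraction_factor R S S96) => h1.
have := le_trans h1 hab; rewrite /b /=.
rewrite -[\sum_(d in P) (Hr t (X t d) - Hr t u)]/b; lra.
Qed.

(** The event that X_t takes its value at d ignores the draws of the t-th call, so [contraction]
    applies with it as [P]; on it the initial gap is constant. *)
Lemma nock_condexpect (t : 'I_T) d :
  (condexpect (fun d' => nock_H F G h x0 mu0 t (X t.+1 d') - nock_Hmin F G h x0 mu0 t)
    (X t) d
   <= (4^-1)%:E * (nock_H F G h x0 mu0 t (X t d) - nock_Hmin F G h x0 mu0 t))%E.
Proof.
have [u [Du umin ->]] := minimizer t.
rewrite /condexpect /uavg; set P := [set _ | _]%SET.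
have Pd : d \in P by rewrite finset.in_set.
have P0 : 0 < #|P|%:R :> R by rewrite ltr0n; apply/card_gt0P; exists d.
have invP := invariant_level (X t d) (@X_inv t).
rewrite (eq_bigr (fun d' => (Hr t (X t.+1 d') - Hr t u)%:E)); last first.
  by move=> d' _; rewrite nock_HE -?EFinB//; exact: DX.
rewrite sumEFin nock_HE; last exact: DX (ltnW (ltn_ord t)).
rewrite -EFinB -!EFinM lee_fin.
have hc := contraction Du umin invP.
have lvl : \sum_(d' in P) (Hr t (X t d') - Hr t u) = #|P|%:R * (Hr t (X t d) - Hr t u).
  rewrite mulr_natl -sumr_const; apply: eq_bigr => d'.
  by rewrite finset.in_set => /eqP ->.
rewrite -/P lvl in hc.
rewrite ler_pdivrMl// (le_trans hc)//.
have b0 : 0 <= Hr t (X t d) - Hr t u by rewrite subr_ge0; apply: umin; exact: DX (ltnW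
  (ltn_ord t)).
have := mulr_ge0 (ltW P0) b0; lra.
Qed.

Let N : R := #|{: W}|%:R.

Let N_gt0 : 0 < N.
Proof. by rewrite ltr0n card_ffun expn_gt0 card_ord n2_gt0. Qed.

Let invT (t : 'I_T) : invariant_on (fun i => i \in codom (iota t)) (fun d : W => d \in
  [set: W]%SET).
Proof. by move=> d d' _; rewrite !inE. Qed.

Let Hr0 t x : Hr t x = f x + fine (h x) + mu t / 2 * dotv (x - x0) (x - x0).
Proof. by rewrite /Hr /hr /hregr addrA. Qed.

Let Hs_le x : D x -> Hs <= f x + fine (h x).
Proof. by move=> Dx; have := xs_min x; rewrite !HobjE// lee_fin. Qed.

Let dist_xs : dotv (xs - x0) (xs - x0) <= D_x.
Proof. by rewrite -sqr_l2norm -opprB l2normN. Qed.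

(** If u were farther from x0 than xs, then xs, which minimizes H, would also carry the smaller
    penalty. *)
Let dist_u t u : D u -> (forall w, D w -> Hr t u <= Hr t w) -> dotv (u - x0) (u - x0)
  <= D_x.
Proof.
move=> Du umin; have := umin xs Dxs; rewrite !Hr0 => h1.
have h2 := Hs_le Du; apply: le_trans dist_xs.
rewrite -(ler_pM2l (half_mu_gt0 t)); rewrite /Hs in h2; lra.
Qed.

(** Passing from H_t to H_(t+1) raises no value and lowers the minimum by at most (mu_(t+1)/2) D_x,
    by [dist_u] at the new minimizer. The induction step is 1/12 + 1/4 <= 1/2, and the base uses mu0
    D_x = D_H. *)
Let gap (t : nat) u : (t <= T)%N -> D u -> (forall w, D w -> Hr t u <= Hr t w) ->
  \sum_(d in [set: W]%SET) (Hr t (X t d) - Hr t u) <= N * (mu t * D_x).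
Proof.
have cst_sum (c : R) : \sum_(d in [set: W]%SET) c = N * c.
  by rewrite sumr_const -[c *+ _]mulr_natl cardsT.
elim: t u => [|t IH] u tT Du umin.
  rewrite (eq_bigr (fun=> Hr 0 x0 - Hr 0 u)); last by move=> d _; rewrite /X /nock_x
    /nock take0.
  rewrite cst_sum ler_pM2l// [X in _ <= X]mu0E.
  have := H_gap; rewrite !HobjE// -EFinB lee_fin.
  have := Hs_le Du; rewrite !Hr0 subrr dotv0r mulr0 addr0 /Hs.
  have := mulr_ge0 (ltW (half_mu_gt0 0)) (dotvv_ge0 (u - x0)); lra.
have [u' [Du' umin' _]] := minimizer t.
have IHt := IH u' (ltnW tT) Du' umin'.
have := contraction (t := Ordinal tT) Du' umin' (@invT _) => /= hc.
apply: (@le_trans _ _ (\sum_(d in [set: W]%SET) ((Hr t (X t.+1 d) - Hr t u') + mu t.+1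
  / 2 * D_x))).
  apply: ler_sum => d _.
  have h1 := umin' u Du; have h2 := dist_u Du umin.
  have := ler_wpM2l (ltW (half_mu_gt0 t.+1)) h2.
  have := mulr_ge0 (ltW (half_mu_gt0 t.+1)) (dotvv_ge0 (X t.+1 d - x0)).
  move: h1; rewrite !Hr0 !nock_muS; lra.
have Dx_ge0 : 0 <= D_x := le_trans (sqr_ge0 _) x0_dist.
have := mulr_ge0 (ltW N_gt0) (mulr_ge0 (ltW (mu_gt0 t)) Dx_ge0).
rewrite big_split /= cst_sum; lra.
Qed.

(** Dropping the penalty crudely would leave (mu_t/2) D_x, already all of mu_T D_x when T = t + 1.
    Quadratic growth at xs and at x, the latter spending a second copy of the gap, recovers a third
    of |xs - x0|^2 by splitting this vector into three. *)
Let final_gap (t : nat) u x : D u -> (forall w, D w -> Hr t u <= Hr t w) -> D x ->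
  f x + fine (h x) - Hs <= 2 * (Hr t x - Hr t u) + mu t / 3 * D_x.
Proof.
move=> Du umin Dx.
have cH : sconvex D (mu t) (Hr t).
  have := sconvexD (chr t) (sconvex_convex cf); rewrite addr0; exact.
have h1 := sconvex_min cH (ltW (mu_gt0 t)) Du umin Dxs.
have h2 := sconvex_min cH (ltW (mu_gt0 t)) Du umin Dx.
have h3 : dotv (xs - x0) (xs - x0) <= 3 * (dotv (xs - u) (xs - u) + dotv (x - x0) (x -
  x0) + dotv (x - u) (x - u)).
  have -> : xs - x0 = (xs - u) + (x - x0) - (x - u).
    by apply/colP => i; rewrite !mxE; ring.
  move: (xs - u) (x - x0) (x - u) => a b c.
  have := dotvv_ge0 (a - b); have := dotvv_ge0 (a + c); have := dotvv_ge0 (b + c).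
  rewrite !dotvL (dotvC b a) (dotvC c a) (dotvC c b); lra.
have := ler_wpM2l (ltW (half_mu_gt0 t)) h3.
have := ler_wpM2l (ltW (half_mu_gt0 t)) dist_xs.
move: h1 h2; rewrite !Hr0 /Hs; lra.
Qed.

(** The constants meet exactly: 2 (1/12) + 1/3 = 1/2, and mu_T = mu_t/2. *)
Lemma nock_expect t : T = t.+1 ->
  (expect (fun d => Hobj F G h (X T d) - Hobj F G h xs) <= (mu T * D_x)%:E)%E.
Proof.
move=> Tt; have tT : (t < T)%N by rewrite Tt.
have [u [Du umin _]] := minimizer t.
have hc := contraction (t := Ordinal tT) Du umin (@invT _).
have hg := gap (ltnW tT) Du umin.
rewrite /expect /uavg (eq_bigr (fun d => (f (X T d) + fine (h (X T d)) - Hs)%:E)); last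
  first.
  by move=> d _; rewrite (HobjE Dxs) (HobjE (DX d (leqnn T))).
rewrite sumEFin -EFinM lee_fin cardsT -/N ler_pdivrMl//.
apply: (@le_trans _ _ (\sum_(d in [set: W]%SET) (2 * (Hr t (X t.+1 d) - Hr t u) + mu t
  / 3 * D_x))).
  by apply: ler_sum => d _; rewrite -Tt; apply: final_gap => //; exact: DX.
rewrite big_split /= -mulr_sumr sumr_const -[_ *+ #|_|]mulr_natl cardsT -/N.
have Dx_ge0 : 0 <= D_x := le_trans (sqr_ge0 _) x0_dist.
have := mulr_ge0 (ltW N_gt0) (mulr_ge0 (ltW (mu_gt0 t)) Dx_ge0).
have muT : mu T = mu t / 2 by rewrite Tt.
rewrite /= in hc hg; rewrite muT; lra.
Qed.

End Nock.

(** * Complexity *)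

Section Cost.
Context {R : realType} {N1 N2 n1 n2 : nat}.
Variables (F : 'I_n1 -> 'cV[R]_N1 -> R) (G : 'I_n2 -> 'cV[R]_N2 -> 'cV[R]_N1).
Variables (L_F B_F L_G B_G L : R).

(** The term n2 + n2 + n1 is the snapshot; the factors 2 count evaluations at both the current point
    and the snapshot, and the final 2 the proximal maps. *)
Definition call_cost S mu : nat := (S * (n2 + n2 + n1 +
  sock_m L mu * (sock_A L_F B_G mu * 2 + sock_B B_F L_G mu * 2 + n1 + 2)))%N.

Lemma sock_inner_cost h mu xt Gt Jt aA aB st j :
  (@sock_inner R N1 N2 n1 n2 F G L_F B_F L_G B_G L h mu xt Gt Jt aA aB st j).2 =
  (sock_A L_F B_G mu * 2 + sock_B B_F L_G mu * 2 + n1 + 2)%N.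
Proof.
case: st => [[y z] w]; rewrite /sock_inner /bind /cmean /=.
rewrite !sum_nat_const !card_ord.
move: (sock_A _ _ _) (sock_B _ _ _) => a b; lia.
Qed.

Lemma sock_outer_cost S h mu aA aB st s :
  ((@sock_outer R N1 N2 n1 n2 F G L_F B_F L_G B_G L S h mu aA aB st s).2 <=
   n2 + n2 + n1 +
  sock_m L mu * (sock_A L_F B_G mu * 2 + sock_B B_F L_G mu * 2 + n1 + 2))%N.
Proof.
case: st => [[xt y] z]; rewrite /sock_outer /bind /cmean /=.
set c := cfold _ _ _.
have : (c.2 <= sock_m L mu * (sock_A L_F B_G mu * 2 + sock_B B_F L_G mu * 2 + n1 + 2))%N.
  rewrite -[X in (X * _)%N]card_ord -sum_nat_const -big_enum.
  by apply: cfold_snd => st j; rewrite sock_inner_cost.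
case: c => [[[y' z'] w] k] /= hk.
by rewrite !sum_nat_const !card_ord !muln1 !addn0 !addnA leq_add2l.
Qed.

Lemma sock_cost S h mu x aA aB :
  ((@sock R N1 N2 n1 n2 F G L_F B_F L_G B_G L S h mu x aA aB).2 <= call_cost S mu)%N.
Proof.
rewrite /sock /bind /= addn0 /call_cost.
rewrite -[X in (X * _)%N]card_ord -sum_nat_const -big_enum.
by apply: cfold_snd => st s; exact: sock_outer_cost.
Qed.

Lemma nock_costP h x0 S mu0 T d :
  (nock_cost F G L_F B_F L_G B_G L S h x0 mu0 T d <= \sum_(i < T) call_cost S (nock_mu
    mu0 i))%N.
Proof.
rewrite /nock_cost /nock -big_enum /=.
rewrite take_oversize ?size_enum_ord//.
by apply: cfold_snd => x i; exact: sock_cost.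
Qed.

Hypotheses (n1_gt0 : (0 < n1)%N).

(** With b = mu^(-1/2) the batches are of order M b^4 and m <= sqrt(L) b, whence M b^5, the origin
    of the exponent 5/2. The units lost by rounding are absorbed by n1 >= 1. *)
Lemma call_cost_le S mu : 0 < mu -> mu <= L ->
  (call_cost S mu)%:R <= S%:R * (2 * (n1 + n2)%:R + Num.sqrt L *
     (2880 * Num.max (B_G ^+ 4 * L_F ^+ 2) (B_F ^+ 2 * L_G ^+ 2) * Num.sqrt mu^-1 ^+ 5
      + 10 * n1%:R * Num.sqrt mu^-1)).
Proof.
move=> mu0 muL.
set M := Num.max _ _; set b := Num.sqrt mu^-1.
have b2 : b ^+ 2 = mu^-1 by rewrite sqr_sqrtr// invr_ge0 ltW.
have b0 : 0 <= b := sqrtr_ge0 _.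
have sE : Num.sqrt (L / mu) = Num.sqrt L * b by rewrite sqrtrM// (le_trans (ltW mu0)).
have hm : (sock_m L mu)%:R <= Num.sqrt L * b by rewrite -sE; exact: sock_m_le.
have max1 (a : R) : 0 <= a -> (maxn 1 (nceil a))%:R <= a + 1.
  by move=> a0; rewrite /maxn; case: ifP => _; [rewrite ltW// nceil_lt|lra].
have B4 : 0 <= B_G ^+ 4 by rewrite (_ : 4 = 2 * 2)%N// exprM sqr_ge0.
have mu2 : 0 < mu ^+ 2 by rewrite exprn_gt0.
have b4 : mu ^- 2 = b ^+ 4 by rewrite (_ : 4 = 2 * 2)%N// exprM b2 exprVn.
have b40 : 0 <= b ^+ 4 by rewrite exprn_ge0.
have hA : (sock_A L_F B_G mu)%:R <= 720 * M * b ^+ 4 + 1.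
  apply: le_trans (max1 _ _) _.
    exact: divr_ge0 (mulr_ge0 (mulr_ge0 (ler0n R 720) B4) (sqr_ge0 _)) (ltW mu2).
  have MA : B_G ^+ 4 * L_F ^+ 2 * b ^+ 4 <= M * b ^+ 4.
    by apply: (ler_wpM2r b40); rewrite /M le_max lexx.
  rewrite b4; lra.
have hB : (sock_B B_F L_G mu)%:R <= 720 * M * b ^+ 4 + 1.
  apply: le_trans (max1 _ _) _.
    exact: divr_ge0 (mulr_ge0 (mulr_ge0 (ler0n R 720) (sqr_ge0 _)) (sqr_ge0 _)) (ltW mu2).
  have MB : B_F ^+ 2 * L_G ^+ 2 * b ^+ 4 <= M * b ^+ 4.
    by apply: (ler_wpM2r b40); rewrite /M le_max lexx orbT.
  rewrite b4; lra.
have n1R : 1 <= n1%:R :> R by rewrite ler1n.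
have n2R : 0 <= n2%:R :> R by [].
rewrite /call_cost natrM ler_wpM2l// !natrD natrM !natrD !natrM.
have h1 : (sock_A L_F B_G mu)%:R * 2 + (sock_B B_F L_G mu)%:R * 2 + n1%:R + 2
   <= 2880 * M * b ^+ 4 + 7 * n1%:R :> R by lra.
have M0 : 0 <= M by rewrite /M le_max mulr_ge0// sqr_ge0.
have h2 : (sock_m L mu)%:R * ((sock_A L_F B_G mu)%:R * 2 + (sock_B B_F L_G mu)%:R * 2 +
  n1%:R + 2)
  <= (Num.sqrt L * b) * (2880 * M * b ^+ 4 + 7 * n1%:R).
  apply: (ler_pM (ler0n R _) _ hm h1).
  exact: (addr_ge0 (addr_ge0 (addr_ge0 (mulr_ge0 (ler0n R _) (ler0n R 2))
    (mulr_ge0 (ler0n R _) (ler0n R 2))) (ler0n R _)) (ler0n R 2)).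
have sb : 0 <= Num.sqrt L * b * n1%:R by rewrite !mulr_ge0 ?sqrtr_ge0.
have h3 : (Num.sqrt L * b) * (2880 * M * b ^+ 4 + 7 * n1%:R) =
   Num.sqrt L * (2880 * M * b ^+ 5 + 7 * n1%:R * b) by rewrite [b ^+ 5]exprS; ring.
rewrite h3 in h2.
lra.
Qed.

End Cost.

(** * Summing the costs of the calls *)

Section Geometric.
Context {R : realType}.

Lemma geometric_sum (b : nat -> R) t : (forall i, 0 <= b i) ->
  (forall i, b i <= 3 / 4 * b i.+1) -> (0 < t)%N -> \sum_(i < t) b i <= 4 * b t.-1.
Proof.
move=> b0 bS; case: t => // t _; elim: t => [|t IH].
  by rewrite big_ord_recl big_ord0 addr0; have := b0 0; lra.
rewrite big_ord_recr /=; have := bS t; have := IH; lra.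
Qed.

(** The exact ratio is 1/sqrt(2); the rational bound 3/4 makes the geometric sum 1/(1 - 3/4) = 4
    times its last term. *)
Lemma sqrt_inv_mu (mu0 : R) t : 0 < mu0 ->
  Num.sqrt (nock_mu mu0 t)^-1 <= 3 / 4 * Num.sqrt (nock_mu mu0 t.+1)^-1.
Proof.
move=> m0; have m := nock_mu_gt0 t m0.
rewrite nock_muS invfM invrK (mulrC _ 2) sqrtrM//.
set s := Num.sqrt _^-1.
have s0 : 0 <= s by exact: sqrtr_ge0.
have r0 : 0 <= Num.sqrt 2 :> R by exact: sqrtr_ge0.
have r2 : Num.sqrt 2 ^+ 2 = 2 :> R by rewrite sqr_sqrtr.
have h : 4 / 3 <= Num.sqrt 2 :> R.
  rewrite -(@ler_pXn2r _ 2)// ?nnegrE// r2 expr2; lra.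
have := ler_wpM2r s0 h; lra.
Qed.

End Geometric.

(** Rounding is controlled on both sides: q <= 2^T serves the accuracy, 2^(T-1) <= q the cost of the
    last and most expensive call. *)
Lemma log2_bounds {R : realType} (q : R) : 1 < q ->
  let T := nceil (ln q / ln 2) in
  [/\ (0 < T)%N, q <= 2 ^+ T, 2 ^+ T.-1 <= q & T%:R <= ln q / ln 2 + 1].
Proof.
move=> q1 T; have q0 : 0 < q by rewrite (lt_trans ltr01).
have ln2 : 0 < ln (2 : R) by rewrite ln_gt0// ltr1n.
have lnq : 0 < ln q by rewrite ln_gt0.
have r0 : 0 < ln q / ln 2 by rewrite divr_gt0.
have leT := le_nceil (ltW r0); have ltT := nceil_lt (ltW r0).
have T0 : (0 < T)%N by rewrite -(ltr0n R) (lt_le_trans r0).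
have p2 k : (0 : R) < 2 ^+ k by rewrite exprn_gt0.
have lnp k : ln (2 ^+ k : R) = k%:R * ln 2 by rewrite lnXn// mulr_natl.
split=> //; last exact: ltW.
- rewrite -ler_ln ?posrE// lnp -ler_pdivrMr//; exact: leT.
- rewrite -ler_ln ?posrE// lnp -ler_pdivlMr//.
  have : T%:R < ln q / ln 2 + 1 := ltT.
  by rewrite -(prednK T0) -natr1 /= => h; rewrite ltW// -(ltrD2r 1).
Qed.

Lemma powR52 {R : realType} (x : R) : 0 <= x -> x `^ (5 / 2) = Num.sqrt x ^+ 5.
Proof.
by move=> x0; rewrite mulrC powRrM powR12_sqrt// powR_mulrn// sqrtr_ge0.
Qed.

Lemma nock_cost_bound {R : realType} {N1 N2 n1 n2 : nat}
    (F : 'I_n1 -> 'cV[R]_N1 -> R) (G : 'I_n2 -> 'cV[R]_N2 -> 'cV[R]_N1)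
    (h : 'cV[R]_N2 -> \bar R) (L_F B_F L_G B_G L : R)
    (x0 : 'cV[R]_N2) (S T : nat) (D_H D_x eps : R) :
  let mu0 := D_H / D_x in
  forall d : draws L_F B_F L_G B_G L S mu0 T,
  (0 < n1)%N -> 0 < D_H -> 0 < D_x -> 0 < eps -> mu0 <= L ->
  (0 < T)%N -> 2 ^+ T.-1 <= D_H / eps -> T%:R <= ln (D_H / eps) / ln 2 + 1 ->
  (nock_cost F G L_F B_F L_G B_G L S h x0 mu0 T d)%:R <=
    S%:R * (2 / ln 2 + 20000) * ((n1 + n2)%:R * Num.max 1 (ln (D_H / eps))
                + D_x `^ (5 / 2) * Num.sqrt L
                  * Num.max (B_G ^+ 4 * L_F ^+ 2) (B_F ^+ 2 * L_G ^+ 2)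
                  / eps `^ (5 / 2)
                + Num.sqrt (D_x * L) * n1%:R / Num.sqrt eps).
Proof.
move=> mu0 d n1_gt0 DH0 Dx0 eps0 mu0L T0 Tq TL; set M := Num.max (B_G ^+ 4 * _) _.
set Lg := Num.max 1 _.
have mu0_gt0 : 0 < mu0 by rewrite divr_gt0.
pose b t := Num.sqrt (nock_mu mu0 t)^-1.
have b0 t : 0 <= b t := sqrtr_ge0 _.
have bS t : b t <= 3 / 4 * b t.+1 by exact: sqrt_inv_mu.
pose be := Num.sqrt D_x / Num.sqrt eps.
have be0 : 0 <= be by rewrite divr_ge0 ?sqrtr_ge0.
(* At the last call 1/mu = (D_x/D_H) 2^(T-1), which is at most D_x/eps. *)
have bT : b T.-1 <= be.
  rewrite /be -sqrtrV ?(ltW eps0)// -sqrtrM ?(ltW Dx0)// ler_wsqrtr//.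
  have -> : (nock_mu mu0 T.-1)^-1 = D_x * (D_H^-1 * 2 ^+ T.-1).
    by rewrite nock_muE /mu0 !invf_div mulrC -mulrA.
  by rewrite ler_pM2l// ler_pdivrMl.
have M0 : 0 <= M by rewrite /M le_max [X in _ || X]mulr_ge0 ?orbT ?sqr_ge0.
have sum1 : \sum_(i < T) b i <= 4 * be.
  rewrite (le_trans (geometric_sum b0 bS T0))//.
  by rewrite ler_pM2l.
have sum5 : \sum_(i < T) b i ^+ 5 <= 4 * be ^+ 5.
  have b50 t : 0 <= b t ^+ 5 by rewrite exprn_ge0.
  have b5S t : b t ^+ 5 <= 3 / 4 * b t.+1 ^+ 5.
    have : b t ^+ 5 <= (3 / 4 * b t.+1) ^+ 5 by rewrite lerXn2r// nnegrE// mulr_ge0//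
      divr_ge0.
    have := b50 t.+1; rewrite exprMn; move: (b t.+1 ^+ 5) (b t ^+ 5) => u v u0.
    by rewrite !exprS expr0; nra.
  rewrite (le_trans (geometric_sum b50 b5S T0))//.
  by rewrite ler_pM2l// lerXn2r// nnegrE.
have hcost : (nock_cost F G L_F B_F L_G B_G L S h x0 mu0 T d)%:R <=
    S%:R * (T%:R * (2 * (n1 + n2)%:R)
     + Num.sqrt L * (2880 * M * (4 * be ^+ 5) + 10 * n1%:R * (4 * be))).
  apply: (@le_trans _ _ (\sum_(i < T) S%:R * (2 * (n1 + n2)%:R
     + Num.sqrt L * (2880 * M * b i ^+ 5 + 10 * n1%:R * b i)))).
    have hc := nock_costP F G h x0 d; rewrite -(ler_nat R) in hc.
    apply: (le_trans hc).
    rewrite natr_sum; apply: ler_sum => i _; apply: call_cost_le => //; first exact: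
      nock_mu_gt0.
    exact: le_trans (nock_mu_le _ mu0_gt0) mu0L.
  rewrite -mulr_sumr ler_wpM2l// big_split /= sumr_const card_ord -[X in X + _ <=
    _]mulr_natl lerD2l.
  rewrite -mulr_sumr ler_wpM2l ?sqrtr_ge0// big_split /= -!mulr_sumr.
  exact: lerD (ler_wpM2l (mulr_ge0 (ler0n R 2880) M0) sum5)
    (ler_wpM2l (mulr_ge0 (ler0n R 10) (ler0n R n1)) sum1).
apply: (le_trans hcost); rewrite -[leRHS]mulrA; apply: (ler_wpM2l (ler0n R S)).
have Lg1 : 1 <= Lg by rewrite /Lg le_max lexx.
have ln2 : 0 < ln (2 : R) by rewrite ln_gt0// ltr1n.
have TLg : T%:R <= (1 / ln 2 + 1) * Lg.
  have -> : (1 / ln 2 + 1) * Lg = Lg / ln 2 + Lg by ring.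
  apply: (le_trans TL); apply: lerD => //.
  have iln2 : 0 <= (ln (2 : R))^-1 by rewrite invr_ge0 ltW.
  by apply: (ler_wpM2r iln2); rewrite /Lg le_max lexx orbT.
have e2 : D_x `^ (5 / 2) * Num.sqrt L * M / eps `^ (5 / 2) = Num.sqrt L * M * be ^+ 5.
  by rewrite !powR52 ?ltW// /be expr_div_n; ring.
have e3 : Num.sqrt (D_x * L) * n1%:R / Num.sqrt eps = Num.sqrt L * n1%:R * be.
  by rewrite sqrtrM ?(ltW Dx0)// /be; ring.
rewrite e2 e3.
have sL : 0 <= Num.sqrt L := sqrtr_ge0 _.
have nn : 0 <= (n1 + n2)%:R :> R by [].
have h1 := ler_wpM2r nn TLg.
have il2 : 0 <= 1 / ln 2 :> R by rewrite divr_ge0// ltW.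
have p2 : 0 <= Num.sqrt L * M * be ^+ 5 by rewrite !mulr_ge0// exprn_ge0.
have p3 : 0 <= Num.sqrt L * n1%:R * be by rewrite !mulr_ge0.
have p1 : 0 <= (n1 + n2)%:R * Lg by rewrite mulr_ge0// (le_trans ler01).
have c2 := mulr_ge0 il2 p2; have c3 := mulr_ge0 il2 p3.
have -> : 2 / ln 2 = 2 * (1 / ln 2) :> R by rewrite mulrA mulr1.
(* The numbers 2880 * 4 and 10 * 4 stay below 20000, and the logarithmic term takes 2/ln 2 + 2. *)
have -> : Num.sqrt L * (2880 * M * (4 * be ^+ 5) + 10 * n1%:R * (4 * be)) =
  11520 * (Num.sqrt L * M * be ^+ 5) + 40 * (Num.sqrt L * n1%:R * be) by ring.
move: (1 / ln 2) (Num.sqrt L * M * be ^+ 5) (Num.sqrt L * n1%:R * be) p2 p3 c2 c3 il2 h1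
  => iln P2 P3 p2 p3 c2 c3 il2 h1.
have c1 := mulr_ge0 il2 p1.
lra.
Qed.


(** * Accuracy and total cost of NoCK *)

Theorem theorem6p2 (R : realType) :
  exists S0 : nat, forall S : nat, (S0 <= S)%N ->
  exists C : R,
  forall (N1 N2 n1 n2 : nat)
    (F : 'I_n1 -> 'cV[R]_N1 -> R) (G : 'I_n2 -> 'cV[R]_N2 -> 'cV[R]_N1)
    (h : 'cV[R]_N2 -> \bar R) (L_F B_F L_G B_G L : R)
    (x0 xstar : 'cV[R]_N2) (D_H D_x eps : R),
  let f := fobj F G in
  let H := Hobj F G h in
  let mu0 := D_H / D_x in
  let T := nceil (ln (D_H / eps) / ln 2) in
  let X := nock_x F G L_F B_F L_G B_G L S h x0 mu0 T in
  let cost := nock_cost F G L_F B_F L_G B_G L S h x0 mu0 T in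
  let Ht := nock_H F G h x0 mu0 in
  let Htmin := nock_Hmin F G h x0 mu0 in
  (0 < n1)%N -> (0 < n2)%N ->
  (forall i u, differentiable (F i) u) ->
  (forall j x, differentiable (G j) x) ->
  proper_closed_convex h ->
  convex_function setT f ->
  (forall i u u', l2norm (grad (F i) u - grad (F i) u') <= L_F * l2norm (u - u')) ->
  (forall i u, l2norm (grad (F i) u) <= B_F) ->
  (forall j x x', opnorm (jac (G j) x - jac (G j) x') <= L_G * l2norm (x - x')) ->
  (forall j x, opnorm (jac (G j) x) <= B_G) ->
  (forall i j x y,
     l2norm ((jac (G j) x)^T *m grad (F i) (Gbar G x)
             - (jac (G j) y)^T *m grad (F i) (Gbar G y)) <= L * l2norm (x - y)) ->
  (forall x, H xstar <= H x)%E ->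
  (H x0 - H xstar <= D_H%:E)%E ->
  l2norm (x0 - xstar) ^+ 2 <= D_x ->
  0 < D_H -> 0 < D_x -> 0 < eps < D_H -> mu0 <= L ->
  [/\ forall (t : 'I_T) d,
        (condexpect (fun d' => Ht t (X t.+1 d') - Htmin t) (X t) d
         <= (4^-1)%:E * (Ht t (X t d) - Htmin t))%E,
      (expect (fun d => H (X T d) - H xstar) <= eps%:E)%E
    & forall d,
        (cost d)%:R <= C * ((n1 + n2)%:R * Num.max 1 (ln (D_H / eps))
                + D_x `^ (5 / 2) * Num.sqrt L
                  * Num.max (B_G ^+ 4 * L_F ^+ 2) (B_F ^+ 2 * L_G ^+ 2)
                  / eps `^ (5 / 2)
                + Num.sqrt (D_x * L) * n1%:R / Num.sqrt eps)].
Proof.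
(* The threshold comes from [contraction_factor]; the constant depends on [S] alone and is fixed
   before any problem data. *)
exists 96%N => S S96; exists (S%:R * (2 / ln 2 + 20000)).
move=> N1 N2 n1 n2 F G h L_F B_F L_G B_G L x0 xs D_H D_x eps f H mu0 T X cost Ht Htmin.
move=> n1_gt0 n2_gt0 dF dG hP cf F_smooth F_bnd G_smooth G_bnd f_smooth xs_min H_gap
  x0_dist.
move=> DH0 Dx0 /andP[eps0 epsD] mu0L.
have mu0_gt0 : 0 < mu0 by rewrite divr_gt0.
have mu0E : mu0 * D_x = D_H by rewrite /mu0 divfK// gt_eqF.
have q1 : 1 < D_H / eps by rewrite ltr_pdivlMr// mul1r.
have [T0 qT Tq TL] := log2_bounds q1; rewrite -/T in T0 qT Tq TL.
have muE t : nock_mu mu0 t * D_x = D_H / 2 ^+ t by rewrite nock_muE mulrAC mu0E.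
split.
- exact: (nock_condexpect n1_gt0 n2_gt0 dF dG hP cf F_smooth F_bnd G_smooth G_bnd f_smooth
    xs_min H_gap mu0_gt0 mu0L S96).
- have := nock_expect n1_gt0 n2_gt0 dF dG hP cf F_smooth F_bnd G_smooth G_bnd f_smooth
    xs_min H_gap x0_dist mu0_gt0 mu0L mu0E S96 (esym (prednK T0)).
  (* The bound mu_T D_x equals D_H/2^T, at most eps since T is rounded up. *)
  move=> /le_trans; apply; rewrite lee_fin muE ler_pdivrMr ?exprn_gt0//.
  by rewrite mulrC -ler_pdivrMr.
move=> d; exact: nock_cost_bound.
Qed.
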